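(* Let $D$ be a weighted oriented graph with $V(D)=\{x_1,\dots,x_k\}$ whose underlying graph is a path $G=(x_1,\dots,x_k)$, let $K$ be a field and $R=K[x_1,\dots,x_k]$. Then the following conditions are equivalent: 1) $R/I(D)$ is Cohen-Macaulay. 2) $I(D)$ is unmixed. 3) $k=2$ or $k=4$; and in the second case ($k=4$), if $(x_2,x_1)\in E(D)$ or $(x_3,x_4)\in E(D)$, then $w(x_2)=1$ or $w(x_3)=1$, respectively (that is, $(x_2,x_1)\in E(D)$ implies $w(x_2)=1$, and $(x_3,x_4)\in E(D)$ implies $w(x_3)=1$).
   Context: A weighted oriented graph is a triplet $D=(V(D),E(D),w)$ where $V=V(D)$ is a finite set, $E=E(D)\subseteq V\times V$ is the edge set of an oriented graph (no loops, and for $x\neq y$ at most one of $(x,y),(y,x)$ is in $E$), and $w:V\to\mathbb{N}=\{1,2,\dots\}$ is the weight function. Its underlying graph $G$ is the simple graph on $V$ with edge set $\{\{x,y\}:(x,y)\in E\}$; here $G=(x_1,\dots,x_k)$ is the path with edges $\{x_i,x_{i+1}\}$, $1\le i<k$. A source is a vertex with no in-neighbours, i.e. a vertex $x$ such that no $(y,x)$ lies in $E$. Standing assumption: if $x$ is a source of $D$, then $w(x)=1$. Vertices are identified with the variables of $R$. The edge ideal is $I(D)=(x_ix_j^{w(x_j)} : (x_i,x_j)\in E)\subseteq R$. An ideal is unmixed if all its associated primes have the same height.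
   Formalization: The path is assumed to have at least one edge, i.e. k ≥ 2; for k = 1 one has I(D) = 0, so R/I(D) is Cohen-Macaulay and I(D) is unmixed while condition 3) fails. *)

(* Defs.v *)
From HB Require Import structures.
From mathcomp Require Import all_boot all_order all_algebra ring_quotient.
From mathcomp Require Import mpoly.
From mathcomp Require boolp.

Set Implicit Arguments.
Unset Strict Implicit.
Unset Printing Implicit Defensive.

Import GRing.Theory.
Local Open Scope ring_scope.

(* Subsets of a ring are boolean predicates.  With the classical [asbool] every
   subset is of this form, so quantifying over [{pred A}] ranges over all
   subsets. *)
Section CommutativeAlgebra.
Variable A : comNzRingType.
Implicit Types (G I P m : {pred A}) (s : seq A).

Definition ideal_gen G : {pred A} := fun a =>
  boolp.asbool (exists n (c g : 'I_n -> A),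
    (forall i, g i \in G) /\ a = \sum_(i < n) c i * g i).

(* [idealr_closed] includes [1 \notin P]. *)
Definition prime_ideal P : Prop := idealr_closed P /\ prime_idealr_closed P.

Definition maximal_ideal m : Prop :=
  idealr_closed m /\
  forall J : {pred A}, idealr_closed J -> {subset m <= J} -> J =i m.

(* P_0 < P_1 < ... < P_n = P, all inclusions strict. *)
Definition prime_chain P (n : nat) : Prop :=
  exists Q : nat -> {pred A},
    [/\ forall i, (i <= n)%N -> prime_ideal (Q i),
        forall i, (i < n)%N ->
          {subset Q i <= Q i.+1} /\ ~ {subset Q i.+1 <= Q i}
      & Q n =i P].

Definition has_height P (n : nat) : Prop :=
  prime_chain P n /\ forall l, prime_chain P l -> (l <= n)%N.

Definition regular_seq s : Prop :=
  (forall i a, (i < size s)%N ->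
     s`_i * a \in ideal_gen (mem (take i s)) -> a \in ideal_gen (mem (take i s)))
  /\ 1 \notin ideal_gen (mem s).

(* The depth (grade) of the ideal [m] on the ring [A] itself. *)
Definition has_depth m (n : nat) : Prop :=
  (exists s, [/\ regular_seq s, {subset s <= m} & size s = n]) /\
  forall s, regular_seq s -> {subset s <= m} -> (size s <= n)%N.

(* P is the annihilator of the class of some f in A/I. *)
Definition associated_prime I P : Prop :=
  prime_ideal P /\ exists f : A, forall g : A, (g \in P) = (g * f \in I).

Definition unmixed I : Prop :=
  exists h : nat, forall P, associated_prime I P -> has_height P h.

End CommutativeAlgebra.

(* For Noetherian A: depth m = height m at every maximal ideal m (Kaplansky,
   Eisenbud).  For m maximal the depth of m on A is the depth of the local ring
   A_m, and the height of m is dim A_m. *)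
Definition cohen_macaulay (A : comNzRingType) : Prop :=
  forall m : {pred A}, maximal_ideal m ->
    exists n : nat, has_height m n /\ has_depth m n.

Record weighted_oriented_graph (V : finType) := WeightedOrientedGraph {
  edge : rel V;
  weight : V -> nat;
  edge_irreflexive : irreflexive edge;
  edge_asymmetric : forall x y : V, edge x y -> ~~ edge y x;
  weight_gt0 : forall x : V, (0 < weight x)%N
}.

Definition source (V : finType) (D : weighted_oriented_graph V) (x : V) : bool :=
  [forall y : V, ~~ edge D y x].

(* The vertex x_(i+1) is the ordinal i, so the path is 0 - 1 - ... - (k-1). *)
Definition underlying_path (k : nat) (D : weighted_oriented_graph 'I_k) : Prop :=
  forall i j : 'I_k, (edge D i j || edge D j i) = (i.+1 == j) || (j.+1 == i).

Section EdgeIdeal.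
Variables (K : fieldType) (k : nat) (D : weighted_oriented_graph 'I_k).

Definition edge_monomials : {pred {mpoly K[k]}} := fun p =>
  [exists i : 'I_k, exists j : 'I_k,
     edge D i j && (p == 'X_i * 'X_j ^+ weight D j)].

Definition edge_ideal : {pred {mpoly K[k]}} := ideal_gen edge_monomials.

Lemma edge_ideal_closed : idealr_closed edge_ideal.
Proof.
split.
- apply/boolp.asboolP; exists 0%N, (fun=> 0), (fun=> 0); split; first by case.
  by rewrite big_ord0.
- apply/negP => /boolp.asboolP [n [c [g [gE /(congr1 (mcoeff 0%MM))]]]].
  rewrite raddf_sum /= mcoeff1 eqxx big1 => [/eqP|l _]; first by rewrite oner_eq0.
  have /existsP[i /existsP[j /andP[_ /eqP->]]] := gE l.
  by rewrite !rmorphM /= mcoeffX mnm1_eq0 mul0r mulr0.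
- move=> a u v /boolp.asboolP [n [c [g [gE ->]]]].
  move=> /boolp.asboolP [n' [c' [g' [gE' ->]]]].
  apply/boolp.asboolP; exists (n + n')%N.
  exists (fun l => match split l with inl i => a * c i | inr i => c' i end).
  exists (fun l => match split l with inl i => g i | inr i => g' i end).
  split; first by move=> l; case: (split l).
  rewrite big_split_ord /= mulr_sumr; congr (_ + _); apply: eq_bigr => l _.
    by rewrite (unsplitK (inl l)) mulrA.
  by rewrite (unsplitK (inr l)).
Qed.

HB.instance Definition _ :=
  isIdealr.Build {mpoly K[k]} edge_ideal edge_ideal_closed.

(* R/I(D) *)
Definition edge_ring : comNzRingType := {ideal_quot edge_ideal}.

End EdgeIdeal.

Arguments edge_ideal K {k} D.
Arguments edge_ring K {k} D.

(* Main.v *)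
Require Import Defs.
From mathcomp Require Import all_boot all_order all_algebra generic_quotient ring_quotient.
From mathcomp Require Import mpoly.
From mathcomp Require boolp classical_sets.
From mathcomp Require Import ring zify.

(** The depth and the height of a maximal ideal are compared through two tools.
    A filtration of [R/I], with factors [R/(I+z)] and [R/(I:z)] for variables
    [z], whose last factors are quotients by primes [(x_i, i in S)], controls
    the associated primes, the dimension and regular sequences.  For [k = 4] and
    [x_2 -> x_3] (the other case is symmetric), condition 3 says that
    [I(D) = (x_1^a x_2^b, x_2 x_3^c, x_3^c x_4^d)]; it has such a filtration with
    primes [(x_1,x_3)], [(x_2,x_3)], [(x_2,x_4)], and every maximal ideal contains
    a regular sequence [f(x_1 + x_2), g(x_3 + x_4)] with [f], [g] univariate,
    provided by the Nullstellensatz in two variables.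

    In the remaining cases [I(D)] has associated primes [(x_i, i in B)] and
    [(x_i, i in S)] with [#|B| < #|S|], so it is not unmixed; at the origin the
    height is at least [k - #|B|], and the depth at most [k - #|S|].

    The bounds on dimension and depth come from algebraic dependence: more than
    [k - #|S|] polynomials satisfy a nontrivial relation modulo [(x_i, i in S)].
    Factoring out its lexicographically least monomial gives a relation which can
    be cancelled step by step along a chain of primes (Coquand and Lombardi) or
    along a regular sequence. *)

Set Implicit Arguments.
Unset Strict Implicit.
Unset Printing Implicit Defensive.

Import GRing.Theory.
Local Open Scope ring_scope.

(** * Ideals and weakly regular sequences *)

Section Ideals.
Variable A : comNzRingType.
Implicit Types (J : A -> Prop) (s : seq A).

(** Ideals are [Prop]-valued predicates and may be the whole ring. By extensionality, ideals with
    the same elements are equal and can be rewritten inside [weakly_regular]. *)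
Definition is_ideal J := J 0 /\ forall a u v, J u -> J v -> J (a * u + v).
Definition adjoin J z : A -> Prop := fun x => exists a, J (x - a * z).
Definition colon J z : A -> Prop := fun x => J (z * x).

Lemma idealM J a u : is_ideal J -> J u -> J (a * u).
Proof. by case=> J0 JD Ju; rewrite -[a * u]addr0; apply: JD. Qed.

Lemma idealD J u v : is_ideal J -> J u -> J v -> J (u + v).
Proof. by case=> J0 JD Ju Jv; rewrite -[u]mul1r; apply: JD. Qed.

Lemma idealN J u : is_ideal J -> J u -> J (- u).
Proof. by move=> Ji Ju; rewrite -mulN1r; apply: idealM. Qed.

Lemma idealB J u v : is_ideal J -> J u -> J v -> J (u - v).
Proof. by move=> Ji Ju Jv; apply: idealD => //; apply: idealN. Qed.

Lemma ideal_sum J (I : eqType) (r : seq I) (F : I -> A) :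
  is_ideal J -> (forall i, i \in r -> J (F i)) -> J (\sum_(i <- r) F i).
Proof.
move=> Ji JF; rewrite big_seq; elim/big_ind: _ => [|u v|]; last exact: JF.
  by case: Ji.
exact: idealD.
Qed.

Lemma ideal_prime_pred (P : {pred A}) : prime_ideal P -> is_ideal (fun x => x \in P).
Proof. by case=> -[P0 _ PD] _; split=> // a u v; apply: PD. Qed.

Lemma adjoin_ideal J z : is_ideal J -> is_ideal (adjoin J z).
Proof.
move=> Ji; split; first by exists 0; rewrite mul0r subr0; case: Ji.
move=> a u v [b Jb] [c Jc]; exists (a * b + c).
have -> : a * u + v - (a * b + c) * z = a * (u - b * z) + (v - c * z) by ring.
by case: Ji => _; apply.
Qed.

Lemma colon_ideal J z : is_ideal J -> is_ideal (colon J z).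
Proof.
move=> Ji; split; first by rewrite /colon mulr0; case: Ji.
move=> a u v Ju Jv; rewrite /colon.
have -> : z * (a * u + v) = a * (z * u) + z * v by ring.
by case: Ji => _; apply.
Qed.

Lemma adjoin_sub J z x : J x -> adjoin J z x.
Proof. by move=> Jx; exists 0; rewrite mul0r subr0. Qed.

Lemma adjoin_gen J z : is_ideal J -> adjoin J z z.
Proof. by case=> J0 _; exists 1; rewrite mul1r subrr. Qed.

Lemma adjoin_min J J' z x :
  is_ideal J' -> (forall y, J y -> J' y) -> J' z -> adjoin J z x -> J' x.
Proof.
move=> Ji' sJ Jz [a Ja]; rewrite -[x](subrK (a * z)).
by apply: idealD => //; [apply: sJ | apply: idealM].
Qed.

Lemma adjoinCA J y z : adjoin (adjoin J y) z = adjoin (adjoin J z) y.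
Proof.
apply: boolp.funext => x; apply: boolp.propext.
by split=> -[a [b Jab]]; exists b, a; rewrite addrAC.
Qed.

(** Properness of the ideal generated in the end is left out, so that zero quotients may occur in
    filtrations. *)
Fixpoint weakly_regular J s : Prop :=
  if s is y :: s' then
    (forall x, J (y * x) -> J x) /\ weakly_regular (adjoin J y) s'
  else True.

Lemma weakly_regular_total J s : (forall x, J x) -> weakly_regular J s.
Proof.
elim: s J => //= y s IHs J Jt; split=> [x _|]; first exact: Jt.
by apply: IHs => x; apply: adjoin_sub.
Qed.

(* The exact sequence 0 -> A/(J:z) -> A/J -> A/(J+z) -> 0. *)
Lemma weakly_regular_filtration J z s : is_ideal J ->
  weakly_regular (adjoin J z) s -> weakly_regular (colon J z) s ->
  weakly_regular J s.
Proof.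
elim: s J => //= y s IHs J Ji [regD wregD] [regC wregC].
have regJ x : J (y * x) -> J x.
  move=> Jyx; have [a Ja] := regD x (adjoin_sub z Jyx).
  rewrite -[x](subrK (a * z)); apply: idealD => //.
  rewrite mulrC; apply: regC; rewrite /colon.
  have -> : z * (y * a) = y * x - y * (x - a * z) by ring.
  by apply: idealB => //; apply: idealM.
split=> //; apply: IHs; first exact: adjoin_ideal.
  by rewrite adjoinCA.
(* Taking the colon by [z] commutes with adding [y], because [y] is regular modulo [J + (z)]. *)
suff -> : colon (adjoin J y) z = adjoin (colon J z) y by [].
apply: boolp.funext => x; apply: boolp.propext; split=> -[a Ja].
  have [b Jb] : adjoin J z a.
    apply: regD; exists x.
    have -> : y * a - x * z = - (z * x - a * y) by ring.
    exact: idealN.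
  exists b; rewrite /colon.
  have -> : z * (x - b * y) = (z * x - a * y) + y * (a - b * z) by ring.
  by apply: idealD => //; apply: idealM.
exists (z * a); move: Ja; rewrite /colon.
by have -> : z * (x - a * y) = z * x - z * a * y by ring.
Qed.

(** Induction on [t], filtering by [y]: adding [y] to [J + (y^(t+1))] gives [J + (y)], and the colon
    by [y] is [J + (y^t)] since [y] is regular modulo [J]. *)
Lemma weakly_regular_adjoinX J y s t : is_ideal J ->
  weakly_regular J (y :: s) -> weakly_regular (adjoin J (y ^+ t)) s.
Proof.
move=> Ji [regy wreg]; elim: t => [|t IHt].
  apply: weakly_regular_total => x; exists x.
  by rewrite expr0 mulr1 subrr; case: Ji.
apply: (@weakly_regular_filtration _ y); first exact: adjoin_ideal.
  suff -> : adjoin (adjoin J (y ^+ t.+1)) y = adjoin J y by [].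
  apply: boolp.funext => x; apply: boolp.propext; split.
    apply: adjoin_min; [exact: adjoin_ideal| |exact: adjoin_gen].
    move=> {}x; apply: adjoin_min; first exact: adjoin_ideal.
      by move=> z; apply: adjoin_sub.
    by rewrite exprSr; apply: idealM; [apply: adjoin_ideal|apply: adjoin_gen].
  by rewrite adjoinCA; apply: adjoin_sub.
suff -> : colon (adjoin J (y ^+ t.+1)) y = adjoin J (y ^+ t) by [].
apply: boolp.funext => x; apply: boolp.propext; split=> -[a Ja]; exists a.
  apply: regy; move: Ja; rewrite exprS.
  by have -> : y * x - a * (y * y ^+ t) = y * (x - a * y ^+ t) by ring.
rewrite exprS.
have -> : y * x - a * (y * y ^+ t) = y * (x - a * y ^+ t) by ring.
exact: idealM.
Qed.

Lemma weakly_regular_exp J s t : is_ideal J ->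
  weakly_regular J s -> weakly_regular J [seq y ^+ t | y <- s].
Proof.
elim: s J => //= y s IHs J Ji wreg; split.
  move=> x; elim: t {IHs} => [|t IHt]; first by rewrite expr0 mul1r.
  by rewrite exprS -mulrA => Jx; apply: IHt; apply: wreg.1.
by apply: IHs; [apply: adjoin_ideal|apply: weakly_regular_adjoinX].
Qed.

Definition adjoin_seq J s : A -> Prop := foldl adjoin J s.

Lemma adjoin_seq_ideal J s : is_ideal J -> is_ideal (adjoin_seq J s).
Proof. by elim: s J => //= y s IHs J Ji; apply: IHs; apply: adjoin_ideal. Qed.

Lemma adjoin_seq_min J J' s x : is_ideal J' -> (forall y, J y -> J' y) ->
  (forall y, y \in s -> J' y) -> adjoin_seq J s x -> J' x.
Proof.
move=> Ji'; elim: s J => /= [|y s IHs] J sJ sS; first exact: sJ.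
apply: IHs => [z|z zs]; last by apply: sS; rewrite inE zs orbT.
by apply: adjoin_min => //; apply: sS; rewrite mem_head.
Qed.

Lemma adjoin_seq_sub J s x : J x -> adjoin_seq J s x.
Proof. by elim: s J => //= y s IHs J Jx; apply: IHs; apply: adjoin_sub. Qed.

Lemma adjoin_seq_mem J s x : is_ideal J -> x \in s -> adjoin_seq J s x.
Proof.
elim: s J => //= y s IHs J Ji; rewrite inE => /orP[/eqP->|xs].
  by apply: adjoin_seq_sub; apply: adjoin_gen.
by apply: IHs => //; apply: adjoin_ideal.
Qed.

(** Links the recursive form, suited to induction, with the indexed form used in [regular_seq]. *)
Lemma weakly_regularP J s : weakly_regular J s <->
  forall i x, (i < size s)%N ->
    adjoin_seq J (take i s) (s`_i * x) -> adjoin_seq J (take i s) x.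
Proof.
elim: s J => [|y s IHs] J /=; first by [].
split=> [[regy /IHs wreg] [|i] x lti|wreg]; [exact: regy|exact: wreg|].
split; first by move=> x; apply: (wreg 0%N).
by apply/IHs => i x lti; apply: (wreg i.+1).
Qed.

End Ideals.

(** * Prime ideals and quotient rings *)

Section PrimeIdeals.
Variable A : comNzRingType.
Implicit Types (J S : A -> Prop) (s : seq A) (P : {pred A}).

(** An ideal maximal among those that contain [J] and miss [S] is prime: if [u] and [v] lie outside,
    adding either one brings in elements [s] and [t] of [S], and having [u * v] inside would put
    [s * t] inside. *)
Lemma exists_prime_ideal J S : is_ideal J -> S 1 ->
    (forall x y, S x -> S y -> S (x * y)) -> (forall x, S x -> ~ J x) ->
  exists P, [/\ prime_ideal P, forall x, J x -> x \in P
              & forall x, S x -> x \notin P].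
Proof.
move=> Ji S1 SM SJ.
(* Uniting with [J] takes care of the empty chain in Zorn's lemma: its union is empty, and [U] sends
   it to [J]. *)
pose U (X : A -> Prop) x := X x \/ J x.
pose good X := is_ideal (U X) /\ forall x, S x -> ~ U X x.
have [F FP Ftot|X [[Xi XS] Xmax]] := @classical_sets.Zorn_bigcup A good.
  split; last first.
    move=> x Sx [[X FX Xx]|]; last exact: SJ.
    by have [_ /(_ _ Sx)] := FP _ FX; apply; left.
  split; first by right; case: Ji.
  have lift X u : F X -> U X u -> U (classical_sets.bigcup F id) u.
    by move=> FX [Xu|]; [left; exists X | right].
  move=> a u v [[X FX Xu]|Ju] [[Y FY Yv]|Jv].
  - have [XY|YX] := Ftot _ _ FX FY.
      by apply: (lift Y) => //; apply: (FP _ FY).1.2; left => //; apply: XY.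
    by apply: (lift X) => //; apply: (FP _ FX).1.2; left => //; apply: YX.
  - by apply: (lift X) => //; apply: (FP _ FX).1.2; [left|right].
  - by apply: (lift Y) => //; apply: (FP _ FY).1.2; [right|left].
  - by right; apply: Ji.2.
pose P : {pred A} := fun x => boolp.asbool (U X x).
have PE x : (x \in P) <-> U X x by split=> /boolp.asboolP.
have maxP y : ~ U X y -> exists2 s, S s & adjoin (U X) y s.
  move=> Xy; apply: boolp.contrapT => nS.
  apply: (Xmax (adjoin (U X) y)).
    split=> [x Xx|/(_ y)]; first by apply: adjoin_sub; left.
    by move/(_ (adjoin_gen y Xi)) => Xy'; apply: Xy; left.
  have E : U (adjoin (U X) y) = adjoin (U X) y.
    apply: boolp.funext => x; apply: boolp.propext; split=> [[//|Jx]|]; last by left.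
    by apply: adjoin_sub; right.
  rewrite /good E; split; first exact: adjoin_ideal.
  by move=> x Sx Xx; apply: nS; exists x.
exists P; split; last 1 first.
- by move=> x Sx; apply/negP => /PE; apply: XS.
- split; first split.
  + by apply/PE; case: Xi.
  + by apply/negP => /PE; apply: XS.
  + by move=> a u v /PE Xu /PE Xv; apply/PE; apply: Xi.2.
  move=> u v /PE Xuv; apply/orP.
  apply: boolp.contrapT => /boolp.not_orP[nu nv].
  have [|s Ss [a Xa]] := maxP u; first by move/PE.
  have [|t St [b Xb]] := maxP v; first by move/PE.
  apply: (XS (s * t)); first exact: SM.
  have -> : s * t = t * (s - a * u) + ((a * u) * (t - b * v) + a * b * (u * v)).
    by ring.
  by apply: idealD => //; [|apply: idealD => //]; apply: idealM.
- by move=> x Jx; apply/PE; right.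
Qed.

Lemma ideal_genP (G : {pred A}) x :
  x \in ideal_gen G <-> exists n (c g : 'I_n -> A),
    (forall i, g i \in G) /\ x = \sum_(i < n) c i * g i.
Proof. by split=> /boolp.asboolP. Qed.

Lemma zero_ideal : is_ideal (fun y : A => y = 0).
Proof. by split=> // a u v -> ->; rewrite mulr0 addr0. Qed.

Lemma ideal_gen_mem s x : x \in ideal_gen (mem s) <-> adjoin_seq (fun y => y = 0) s x.
Proof.
have zi := zero_ideal.
split.
  case/ideal_genP=> n [c [g [gs ->]]].
  apply: ideal_sum => [|i _]; first exact: adjoin_seq_ideal.
  apply: idealM; first exact: adjoin_seq_ideal.
  by apply: adjoin_seq_mem => //; apply: gs.
apply: (@adjoin_seq_min _ _ (fun x => x \in ideal_gen (mem s))) => [|y ->|y ys].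
- split.
    by apply/ideal_genP; exists 0%N, (fun=> 0), (fun=> 0); split; [case|rewrite big_ord0].
  move=> a u v /ideal_genP[n [c [g [gE ->]]]] /ideal_genP[n' [c' [g' [gE' ->]]]].
  apply/ideal_genP; exists (n + n')%N.
  exists (fun l => match split l with inl i => a * c i | inr i => c' i end).
  exists (fun l => match split l with inl i => g i | inr i => g' i end).
  split; first by move=> l; case: (split l).
  rewrite big_split_ord /= mulr_sumr; congr (_ + _); apply: eq_bigr => l _.
    by rewrite (unsplitK (inl l)) mulrA.
  by rewrite (unsplitK (inr l)).
- by apply/ideal_genP; exists 0%N, (fun=> 0), (fun=> 0); split; [case|rewrite big_ord0].
- apply/ideal_genP; exists 1%N, (fun=> 1), (fun=> y); split=> //.
  by rewrite big_ord1 mul1r.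
Qed.

Lemma prime_chainS P Q n : prime_ideal Q -> {subset P <= Q} ->
  ~ {subset Q <= P} -> prime_chain P n -> prime_chain Q n.+1.
Proof.
move=> Qp PQ QP [C [Cp Cs CP]].
exists (fun i => if (i <= n)%N then C i else Q); split=> [i _|i|].
- by case: leqP => // /Cp.
- rewrite ltnS => lein; rewrite lein; move: lein; rewrite leq_eqVlt.
  case/orP=> [/eqP->|ltin]; last by rewrite ltin; apply: Cs.
  by rewrite ltnn; split=> [x|sQ]; [rewrite CP; apply: PQ
                           | apply: QP => x /sQ; rewrite CP].
- by rewrite ltnn.
Qed.

Lemma regular_seq_belast s y : regular_seq (rcons s y) -> regular_seq s.
Proof.
case=> reg n1; split=> [i a lti|].
  have := reg i a; rewrite size_rcons nth_rcons lti -cats1 takel_cat ?(ltnW lti) //.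
  by apply; apply: ltnW.
apply/negP => /ideal_gen_mem h; move/negP: n1; apply; apply/ideal_gen_mem.
rewrite /adjoin_seq foldl_rcons; exact: adjoin_sub.
Qed.

(* With [y] regular modulo the ideal of [s], that ideal misses the
   multiplicative set of all [y^e * u] with [u] outside [P], so some prime
   below [P] contains [s] but not [y]. *)
Lemma regular_seq_prime_chain s P : prime_ideal P -> regular_seq s ->
  {subset s <= P} -> prime_chain P (size s).
Proof.
elim/last_ind: s P => [|s y IHs] P Pp reg sP.
  by exists (fun=> P); split.
have sP' x : x \in s -> x \in P.
  by move=> xs; apply: sP; rewrite mem_rcons inE xs orbT.
have yP : y \in P by apply: sP; rewrite mem_rcons mem_head.
pose J := adjoin_seq (fun x : A => x = 0) s.
have Ji : is_ideal J by apply: adjoin_seq_ideal; apply: zero_ideal.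
have Pi := ideal_prime_pred Pp.
have JP x : J x -> x \in P.
  by apply: (@adjoin_seq_min _ _ (fun x => x \in P)) => // z ->; case: Pp => -[].
have regy x : J (y * x) -> J x.
  case: reg => /(_ (size s) x); rewrite size_rcons ltnSn nth_rcons ltnn eqxx.
  rewrite -cats1 take_size_cat // => reg _ /ideal_gen_mem h.
  by apply/ideal_gen_mem; apply: reg.
have regyX e x : J (y ^+ e * x) -> J x.
  by elim: e => [|e IHe]; rewrite ?expr0 ?mul1r // exprS -mulrA => /regy.
pose S x := exists e u, u \notin P /\ x = y ^+ e * u.
have n1P : 1 \notin P by case: Pp => -[].
have [|x z|x|Q [Qp JQ SQ]] := @exists_prime_ideal J S Ji.
- by exists 0%N, 1; rewrite mul1r.
- move=> [e [u [uP ->]]] [e' [u' [uP' ->]]]; exists (e + e')%N, (u * u').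
  split; last by rewrite exprD; ring.
  by apply/negP => /Pp.2; rewrite (negPf uP) (negPf uP').
- by move=> [e [u [/negP uP ->]]] /regyX /JP.
rewrite size_rcons; apply: (@prime_chainS Q) => //.
- move=> x xQ; apply/negPn/negP => xP; have /negP[] // : x \notin Q.
  by apply: SQ; exists 0%N, x; rewrite mul1r.
- move=> /(_ _ yP) yQ; have /negP[] // : y \notin Q.
  by apply: SQ; exists 1%N, 1; rewrite mulr1 expr1.
apply: IHs => //; first exact: regular_seq_belast reg.
by move=> x xs; apply: JQ; apply: adjoin_seq_mem => //; apply: zero_ideal.
Qed.

Lemma prime_chain_ext P Q n : P =i Q -> prime_chain P n -> prime_chain Q n.
Proof. by move=> PQ [C [Cp Cs CP]]; exists C; split=> // x; rewrite CP. Qed.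

Lemma prime_chain_cat P Q n l (C : nat -> {pred A}) : prime_chain P n ->
    C 0%N =i P -> C l =i Q -> (forall i, (i <= l)%N -> prime_ideal (C i)) ->
    (forall i, (i < l)%N -> {subset C i <= C i.+1} /\ ~ {subset C i.+1 <= C i}) ->
  prime_chain Q (n + l).
Proof.
move=> Pn C0 Cl Cp Cs; apply: (prime_chain_ext Cl).
elim: l Cp Cs {Cl} => [|l IHl] Cp Cs.
  by rewrite addn0; apply: prime_chain_ext Pn => x; rewrite C0.
have [sl nsl] := Cs l (ltnSn l).
rewrite addnS; apply: (@prime_chainS (C l)) => //; first exact: Cp.
by apply: IHl => i lei; [apply: Cp; apply: leqW|apply: Cs; apply: leqW].
Qed.

Lemma maximal_inverse (m : {pred A}) x : maximal_ideal m -> x \notin m ->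
  exists y, 1 - x * y \in m.
Proof.
move=> [[m0 m1 mD] mmax] xm; pose J := adjoin (fun y => y \in m) x.
have mi : is_ideal (fun y => y \in m) by split=> // a u v; apply: mD.
have Ji : is_ideal J by apply: adjoin_ideal.
have [[a]|nJ1] := boolp.pselect (J 1); first by exists a; rewrite mulrC.
pose Jp : {pred A} := fun y => boolp.asbool (J y).
have JE y : (y \in Jp) <-> J y by split=> /boolp.asboolP.
case/negP: xm; rewrite -(mmax Jp).
- by apply/JE; apply: adjoin_gen.
- split; first by apply/JE; case: Ji.
    by apply/negP => /JE.
  by move=> a u v /JE Ju /JE Jv; apply/JE; apply: Ji.2.
- by move=> y ym; apply/JE; apply: adjoin_sub.
Qed.

Lemma maximal_prime (m : {pred A}) : maximal_ideal m -> prime_ideal m.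
Proof.
move=> mm; split; first exact: mm.1.
move=> u v uvm; have [//|/(maximal_inverse mm)[y ym] /=] := boolP (u \in m).
have mi : is_ideal (fun y => y \in m) by case: mm => -[m0 m1 mD] _; split=> // a ? ?; apply: mD.
have -> : v = v * (1 - u * y) + y * (u * v) by ring.
by apply: (idealD mi); apply: (idealM _ mi).
Qed.

End PrimeIdeals.

(** * Transfer of ideals, prime chains and regular sequences along a surjection *)

Section Quotient.
Variables (R A : comNzRingType) (pi : {rmorphism R -> A}) (I : R -> Prop).
Hypothesis pi_surj : forall a, exists x, pi x = a.
Hypothesis pi_ker : forall x, pi x = 0 <-> I x.

Lemma adjoin_seq_pi s x :
  adjoin_seq (fun y => y = 0) (map pi s) (pi x) <-> adjoin_seq I s x.
Proof.
suff gen (Z : A -> Prop) (J : R -> Prop) : (forall x, Z (pi x) <-> J x) ->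
    forall x, adjoin_seq Z (map pi s) (pi x) <-> adjoin_seq J s x by apply: gen.
elim: s Z J => [|y s IHs] Z J ZJ //; apply: IHs => {}x; split=> -[a Ja].
  by have [b bE] := pi_surj a; exists b; apply/ZJ; rewrite rmorphB rmorphM bE.
by exists (pi a); rewrite -rmorphM -rmorphB; apply/ZJ.
Qed.

Lemma regular_seq_pi s :
  regular_seq (map pi s) <-> weakly_regular I s /\ ~ adjoin_seq I s 1.
Proof.
rewrite -adjoin_seq_pi rmorph1 -ideal_gen_mem.
have E: (forall i a, (i < size (map pi s))%N ->
     (map pi s)`_i * a \in ideal_gen (mem (take i (map pi s))) ->
     a \in ideal_gen (mem (take i (map pi s)))) <-> weakly_regular I s.
  split=> [h|/weakly_regularP h].
    apply/weakly_regularP => i x lti hx.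
    have := h i (pi x); rewrite size_map lti (nth_map 0) // -map_take -rmorphM.
    by rewrite !ideal_gen_mem !adjoin_seq_pi; apply.
  move=> i a; rewrite size_map => lti; have [x <-] := pi_surj a.
  rewrite (nth_map 0) // -map_take -rmorphM => /ideal_gen_mem/adjoin_seq_pi hx.
  by apply/ideal_gen_mem/adjoin_seq_pi; apply: h.
by rewrite /regular_seq; split=> -[/E h /negP h']; split=> //; apply/E.
Qed.

Definition preim_ideal (P : {pred A}) : {pred R} := fun x => pi x \in P.

Lemma preim_idealE P x : (x \in preim_ideal P) = (pi x \in P).
Proof. by []. Qed.

Lemma prime_preim (P : {pred A}) : prime_ideal P -> prime_ideal (preim_ideal P).
Proof.
case=> -[P0 P1 PD] PM; split; first split; rewrite ?inE ?preim_idealE ?rmorph0 ?rmorph1 //.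
  by move=> a u v; rewrite !preim_idealE rmorphD rmorphM; apply: PD.
by move=> u v; rewrite !preim_idealE rmorphM; apply: PM.
Qed.

Lemma prime_chain_preim (P : {pred A}) n : prime_chain P n -> exists Q : nat -> {pred R},
  [/\ forall i, (i <= n)%N -> prime_ideal (Q i),
      forall i, (i < n)%N -> {subset Q i <= Q i.+1} /\ ~ {subset Q i.+1 <= Q i}
    & forall x, I x -> x \in Q 0%N].
Proof.
case=> C [Cp Cs CP]; exists (fun i => preim_ideal (C i)); split.
- by move=> i lei; apply: prime_preim; apply: Cp.
- move=> i lti; have [sC nsC] := Cs i lti; split=> [x|nC]; first exact: sC.
  apply: nsC => a; have [x <-] := pi_surj a; exact: (nC x).
- by move=> x /pi_ker xI; rewrite preim_idealE xI; case: (Cp 0%N (leq0n n)) => -[].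
Qed.

Definition image_ideal (Q : {pred R}) : {pred A} :=
  fun a => boolp.asbool (exists2 x, pi x = a & x \in Q).

Lemma image_idealE (Q : {pred R}) x : is_ideal (fun x => x \in Q) ->
  (forall x, I x -> x \in Q) -> (pi x \in image_ideal Q) = (x \in Q).
Proof.
move=> Qi IQ; apply/boolp.asboolP/idP => [[y yx yQ]|xQ]; last by exists x.
rewrite -[x](subrK y); apply: (idealD Qi) => //; apply: IQ; apply/pi_ker.
by rewrite rmorphB yx subrr.
Qed.

Lemma prime_image (Q : {pred R}) : prime_ideal Q -> (forall x, I x -> x \in Q) ->
  prime_ideal (image_ideal Q).
Proof.
move=> Qp IQ; have Qi := ideal_prime_pred Qp.
case: Qp => -[Q0 Q1 QD] QM; split; first split.
- by rewrite -(rmorph0 pi) image_idealE //; case: Qi.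
- by rewrite -(rmorph1 pi) image_idealE.
- move=> a u v; have [[b <-] [[x <-] [y <-]]] := (pi_surj a, (pi_surj u, pi_surj v)).
  by rewrite -rmorphM -rmorphD !image_idealE //; apply: QD.
- move=> u v; have [[x <-] [y <-]] := (pi_surj u, pi_surj v).
  by rewrite -rmorphM !image_idealE //; apply: QM.
Qed.

Lemma maximal_image (Q : {pred R}) : is_ideal (fun x => x \in Q) -> 1 \notin Q ->
    (forall x, I x -> x \in Q) -> (forall x, x \notin Q -> exists y, 1 - x * y \in Q) ->
  maximal_ideal (image_ideal Q).
Proof.
move=> Qi Q1 IQ Qinv; split; first split.
- by rewrite -(rmorph0 pi) image_idealE //; case: Qi.
- by rewrite -(rmorph1 pi) image_idealE.
- move=> a u v; have [[b <-] [[x <-] [y <-]]] := (pi_surj a, (pi_surj u, pi_surj v)).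
  by rewrite -rmorphM -rmorphD !image_idealE //; apply: Qi.2.
move=> J [J0 J1 JD] QJ a; apply/idP/idP; last exact: QJ.
have Ji : is_ideal (fun x => x \in J) by split=> // ? ? ?; apply: JD.
have [x <-] := pi_surj a; rewrite image_idealE // => xJ.
apply/negPn/negP => /Qinv[y xyQ]; case/negP: J1.
have -> : 1 = pi (1 - x * y) + pi y * pi x.
  by rewrite rmorphB rmorphM rmorph1; ring.
apply: (idealD Ji); last exact: (idealM _ Ji).
by apply: QJ; rewrite image_idealE.
Qed.

End Quotient.

(** * The Nullstellensatz in two variables *)

Section Nullstellensatz.
Variable K : fieldType.
Implicit Types (p h : {poly K}) (g : {poly {poly K}}).

(** Modulo [p] the leading coefficient of [g] is a unit with inverse [- 'X]. Then [Q * g] has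
    positive degree modulo [p] unless [Q] vanishes there; so [p] divides [Q], hence 1. *)
Lemma bezout_lead_coef_unit p g (Q W : {poly {poly K}}) : (1 < size g)%N ->
  p %| 1 + 'X * lead_coef g -> 1 = Q * g + p%:P * W -> p %| 1.
Proof.
move=> sg ph QW; set h := lead_coef g in ph.
suff dQ n : p %| Q`_n.
  have -> : 1 = Q`_0 * g`_0 + p * W`_0 by rewrite -coef0M -coefCM -coefD -QW coef1.
  by rewrite dvdp_add ?dvdp_mulr.
(* Descending induction on [n]: in degree [n + deg g], the product [Q * g] involves, besides [Q_n]
   times the leading coefficient, only later coefficients of [Q]. *)
have [m] := ubnP (size Q - n); elim: m n => // m IHm n /ltnSE sQn.
have [leQn|ltnQ] := leqP (size Q) n; first by rewrite nth_default ?dvdp0.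
have := congr1 (fun r : {poly {poly K}} => r`_(n + (size g).-1)) QW.
rewrite coef1 coefD coefCM coefM.
have lt_n : (n < (n + (size g).-1).+1)%N by rewrite ltnS leq_addr.
rewrite (bigD1 (Ordinal lt_n)) //= addKn.
have -> : (n + (size g).-1 == 0)%N = false.
  by rewrite addn_eq0; case: (size g) sg => [|[|s]] //= _; rewrite andbF.
move/esym/eqP; rewrite -addrA addr_eq0 => /eqP Qh.
have dQh : p %| Q`_n * h.
  rewrite /h lead_coefE Qh dvdpNr dvdp_add ?dvdp_mulr //.
  elim/big_ind: _ => [|u v|i]; rewrite ?dvdp0 //; first exact: dvdp_add.
  rewrite -val_eqE /= => neq_in.
  have [lt_in|le_ni] := ltnP i n.
    rewrite [g`_ _]nth_default ?mulr0 ?dvdp0 //. by case: i neq_in lt_in => /= i _; lia.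
  have lt_ni : (n < i)%N by rewrite ltn_neqAle eq_sym neq_in.
  by apply/dvdp_mulr/IHm; apply: leq_trans (ltn_sub2l ltnQ lt_ni) sQn.
have -> : Q`_n = Q`_n * (1 + 'X * h) - 'X * (Q`_n * h) by ring.
by rewrite dvdp_sub // dvdp_mull.
Qed.

(* For [g] of least degree in a maximal ideal [J] meeting the constants
   trivially, and [h] its leading coefficient, [J] becomes principal after
   inverting [h].  Then [1 + X h], which is prime to [h], generates the unit
   ideal together with [g], although [g] keeps its positive degree modulo it. *)
Lemma maximal_ideal_meets_constants (J : {poly {poly K}} -> Prop) : is_ideal J ->
    ~ J 1 -> (forall x, ~ J x -> exists y, J (1 - x * y)) ->
  exists2 f : {poly K}, f != 0 & J f%:P.
Proof.
move=> Ji J1 Jinv; apply: boolp.contrapT => nJ.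
have {nJ} nJ (f : {poly K}) : f != 0 -> ~ J f%:P.
  by move=> f0 Jf; apply: nJ; exists f.
(* The constant ['X] lies outside [J], so it has an inverse [y] modulo [J]; [1 - 'X%:P * y] is
   nonzero because its lowest coefficient is 1. *)
have [g0 g0nz Jg0] : exists2 g, g != 0 & J g.
  have [y Jy] := Jinv 'X%:P (nJ _ (negbT (polyX_eq0 _))).
  exists (1 - 'X%:P * y) => //; apply/eqP => /(congr1 (fun r : {poly {poly K}} => r`_0`_0)).
  rewrite coefB coef1 coefCM coefB coef1 coefXM /= !coef0 subr0 => /eqP.
  by rewrite oner_eq0.
pose has_size n := boolp.asbool (exists g, [/\ g != 0, J g & size g = n]).
have exg : exists n, has_size n by exists (size g0); apply/boolp.asboolP; exists g0.
case: (ex_minnP exg) => n /boolp.asboolP[g [g_nz Jg <-]] ming.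
have sg : (1 < size g)%N.
  rewrite ltnNge; apply/negP => /size1_polyC gC; apply: (nJ g`_0); last by rewrite -gC.
  by apply: contra g_nz => /eqP g0'; rewrite gC g0'.
set h := lead_coef g; have h_nz : h != 0 by rewrite lead_coef_eq0.
have [p pE] : exists p, p = 1 + 'X * h by eexists.
have szp : (1 < size p)%N.
  have szX : size ('X * h) = (size h).+1 by rewrite mulrC size_mulX.
  by rewrite pE addrC size_polyDl szX ?size_poly1 ltnS size_poly_gt0.
have p_nz : p != 0 by rewrite -size_poly_gt0 ltnW.
have [q Jq] := Jinv p%:P (nJ p p_nz).
set m := 1 - p%:P * q in Jq.
(* Pseudo-division multiplies [m] by [h ^+ e]; the minimal degree of [g] in [J] then forces the
   remainder to vanish. *)
have md := Pdiv.Idomain.divp_eq m g; set e := scalp m g in md.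
have r0 : m %% g = 0.
  apply/eqP/negPn/negP => r_nz.
  have := ming (size (m %% g)); rewrite leqNgt Pdiv.Idomain.ltn_modp g_nz => /(_ _)/notF.
  apply; apply/boolp.asboolP; exists (m %% g); split=> //.
  have -> : m %% g = (h ^+ e)%:P * m - m %/ g * g by rewrite mul_polyC md; ring.
  by apply: idealB => //; apply: idealM.
suff /dvdp_leq : p %| 1 by rewrite oner_eq0 size_poly1 leqNgt szp => /(_ isT).
(* Since [- ('X * h)] is 1 modulo [p], multiplying the division by [(- 'X) ^+ e] removes [h ^+ e]
   modulo [p] and leaves a Bezout relation between [g] and [p]. *)
have [w wE] : exists w, (- ('X * h)) ^+ e = 1 + p * w.
  elim: e {md} => [|e [w IHe]]; first by exists 0; rewrite mulr0 addr0.
  exists (- 1 + w - w * p); rewrite exprS IHe pE; ring.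
apply: (@bezout_lead_coef_unit p g (((- 'X) ^+ e)%:P * (m %/ g))
          ((- w)%:P + ((- ('X * h)) ^+ e)%:P * q)) => //; first by rewrite -pE.
rewrite -mulrA; have -> : m %/ g * g = (h ^+ e)%:P * m by rewrite mul_polyC md r0 addr0.
have wE' : ((- 'X) ^+ e)%:P * ((h ^+ e)%:P) = 1 + p%:P * w%:P :> {poly {poly K}}.
  by rewrite -!polyCM -exprMn mulNr wE polyCD polyCM polyC1.
by rewrite mulrA wE' /m wE polyCD polyCM polyCN polyC1; ring.
Qed.

End Nullstellensatz.

(** * Monomial ideals and prime filtrations *)

Section MonomialIdeals.
Variables (K : fieldType) (n : nat).
Local Notation R := {mpoly K[n]}.
Implicit Types (T : 'X_{1..n} -> bool) (p : R) (S : {set 'I_n}) (m : 'X_{1..n}).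

Definition upclosed T := forall m m' : 'X_{1..n}, T m -> T (m + m')%MM.

(** A monomial ideal is given by the set [T] of exponents of its monomials; adding a variable or
    taking a colon by it becomes a pointwise operation on [T]. *)
Definition monideal T : R -> Prop := fun p => forall m, m \in msupp p -> T m.

Lemma monidealX T m : monideal T 'X_[m] <-> T m.
Proof.
split=> [|Tm m']; first by apply; rewrite msuppX mem_head.
by rewrite msuppX inE => /eqP->.
Qed.

Lemma monideal_is_ideal T : upclosed T -> is_ideal (monideal T).
Proof.
move=> upT; split=> [m|a u v Tu Tv m]; first by rewrite msupp0.
move=> /msuppD_le; rewrite mem_cat => /orP[|/Tv //].
by case/msuppM_le/allpairsP=> -[m1 m2] /= [_ /Tu Tm2 ->]; rewrite addmC; apply: upT.
Qed.

Lemma monideal_min T (J : R -> Prop) p : is_ideal J ->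
  (forall m, T m -> J 'X_[m]) -> monideal T p -> J p.
Proof.
move=> Ji TJ Tp; rewrite [p]mpolyE; apply: ideal_sum => // m /Tp Tm.
by rewrite -mul_mpolyC; apply: idealM => //; apply: TJ.
Qed.

Lemma mnm_gt0 (m : 'X_{1..n}) i : (0 < m i)%N -> m = (m - U_(i) + U_(i))%MM.
Proof. by move=> m_gt0; rewrite submK // lep1mP -lt0n. Qed.

Lemma adjoin_monideal T i : upclosed T ->
  adjoin (monideal T) 'X_i = monideal (fun m => T m || (0 < m i)%N).
Proof.
move=> upT; have Ti := monideal_is_ideal upT.
have upT' : upclosed (fun m => T m || (0 < m i)%N).
  by move=> m m'; rewrite mnmDE addn_gt0 => /orP[/upT->//|->]; rewrite orbT.
apply: boolp.funext => p; apply: boolp.propext; split.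
  apply: adjoin_min; first exact: monideal_is_ideal.
    by move=> q qT m /qT ->.
  by apply/monidealX; rewrite mnm1E eqxx orbT.
apply: monideal_min; first exact: adjoin_ideal.
move=> m; case/orP=> [Tm|/mnm_gt0->]; first by apply/adjoin_sub/monidealX.
rewrite mpolyXD; apply: idealM; first exact: adjoin_ideal.
exact: adjoin_gen.
Qed.

Lemma colon_monideal T i :
  colon (monideal T) 'X_i = monideal (fun m => T (m + U_(i))%MM).
Proof.
apply: boolp.funext => p; apply: boolp.propext; rewrite /colon mulrC.
split=> [Tp m pm|Tp m].
  by apply: Tp; rewrite (perm_mem (msuppMX _ _)) addmC map_f.
by rewrite (perm_mem (msuppMX _ _)) => /mapP[m' /Tp + ->]; rewrite addmC.
Qed.

Definition meets S : 'X_{1..n} -> bool := fun m => [exists i in S, (0 < m i)%N].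

Lemma meetsP S m : reflect (exists2 i, i \in S & (0 < m i)%N) (meets S m).
Proof. exact: exists_inP. Qed.

Lemma meets_upclosed S : upclosed (meets S).
Proof.
move=> m m' /meetsP[i iS mi]; apply/meetsP; exists i => //.
by rewrite mnmDE addn_gt0 mi.
Qed.

Definition kill S : n.-tuple R := [tuple if i \in S then 0 else 'X_i | i < n].

Lemma comp_killX S (m : 'X_{1..n}) : 'X_[m] \mPo kill S = if meets S m then 0 else 'X_[m] :> R.
Proof.
rewrite /comp_mpoly mmapX /mmap1; case: ifP => [/meetsP[i iS mi]|/negbT/negP Sm].
  by rewrite (bigD1 i) //= tnth_mktuple iS -(prednK mi) exprS !mul0r.
rewrite [RHS]mpolyXE_id; apply: eq_bigr => i _; rewrite tnth_mktuple.
case: ifP => // iS; case: (posnP (m i)) => [->|mi]; first by rewrite !expr0.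
by case: Sm; apply/meetsP; exists i.
Qed.

(** The ideal of the variables in [S] is the kernel of an endomorphism of a domain, whence its
    primality. *)
Lemma comp_kill_eq0 S p : p \mPo kill S = 0 <-> monideal (meets S) p.
Proof.
have E m : (p \mPo kill S)@_m = if meets S m then 0 else p@_m.
  have -> : p \mPo kill S =
      \sum_(m' <- msupp p) p@_m' *: (if meets S m' then 0 else 'X_[m'] : R).
    rewrite /comp_mpoly /mmap; apply: eq_bigr => m' _.
    by rewrite mul_mpolyC -comp_killX /comp_mpoly mmapX.
  rewrite raddf_sum /=; under eq_bigr => m' _ do rewrite mcoeffZ.
  rewrite [in RHS](mpolyE p) raddf_sum /=.
  case: ifP => Sm.
    rewrite big1 // => m' _; case: ifP => Sm'; rewrite ?mcoeff0 ?mulr0 //.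
    rewrite mcoeffX; case: eqP => [mm'|_]; last by rewrite mulr0.
    by rewrite -mm' Sm' in Sm.
  apply: eq_bigr => m' _; rewrite mcoeffZ; case: ifP => // Sm'.
  rewrite mcoeffX mcoeff0; case: eqP => [mm'|_]; rewrite ?mulr0 //.
  by rewrite -mm' Sm' in Sm.
split=> [p0 m|Sp].
  rewrite mcoeff_msupp; apply: contraR => /negPf Sm.
  by have := E m; rewrite p0 mcoeff0 Sm => <-.
apply/mpolyP => m; rewrite E mcoeff0; case: ifP => // /negbT/negP Sm.
by apply/eqP; rewrite mcoeff_eq0; apply/negP => /Sp.
Qed.

Definition varideal S : {pred R} := fun p => boolp.asbool (monideal (meets S) p).

Lemma varidealP S p : (p \in varideal S) <-> monideal (meets S) p.
Proof. by split=> /boolp.asboolP. Qed.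

Lemma varideal_prime S : prime_ideal (varideal S).
Proof.
have Si := monideal_is_ideal (@meets_upclosed S).
split; first split.
- by apply/varidealP; case: Si.
- apply/negP => /varidealP/comp_kill_eq0/eqP; rewrite rmorph1; exact/negP/oner_neq0.
- by move=> a u v /varidealP Su /varidealP Sv; apply/varidealP/Si.2.
move=> u v /varidealP/comp_kill_eq0; rewrite rmorphM => /eqP; rewrite mulf_eq0.
by case/orP=> /eqP/comp_kill_eq0/varidealP->; rewrite ?orbT.
Qed.

Lemma varidealX S i : ('X_i \in varideal S) = (i \in S).
Proof.
apply/idP/idP => [/varidealP/monidealX/meetsP[j jS]|iS].
  by rewrite mnm1E; case: eqP => // ->.
by apply/varidealP/monidealX/meetsP; exists i => //; rewrite mnm1E eqxx.
Qed.

Lemma varideal_min S (J : R -> Prop) p : is_ideal J ->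
  (forall i, i \in S -> J 'X_i) -> p \in varideal S -> J p.
Proof.
move=> Ji SJ /varidealP; apply: monideal_min => // m /meetsP[i iS /mnm_gt0->].
by rewrite mpolyXD; apply: idealM => //; apply: SJ.
Qed.

(** [L] restricts the sets of variables generating the prime factors; the total case stands for the
    zero module. *)
Inductive prime_filtration (L : {set 'I_n} -> Prop) : ('X_{1..n} -> bool) -> Prop :=
| filtration_prime S : L S -> prime_filtration L (meets S)
| filtration_total : prime_filtration L (fun _ => true)
| filtration_step T i : upclosed T ->
    prime_filtration L (fun m => T m || (0 < m i)%N) ->
    prime_filtration L (fun m => T (m + U_(i))%MM) -> prime_filtration L T.

Lemma prime_filtration_regular L T s : prime_filtration L T ->
    (forall S, L S -> weakly_regular (monideal (meets S)) s) ->
  weakly_regular (monideal T) s.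
Proof.
elim=> {T} [S LS||T i upT _ IHD _ IHC] Ls; first exact: Ls.
  by apply: weakly_regular_total => p m.
apply: (@weakly_regular_filtration _ _ 'X_i); first exact: monideal_is_ideal.
  by rewrite adjoin_monideal //; apply: IHD.
by rewrite colon_monideal; apply: IHC.
Qed.

(** Descend to the sum with ['X_i] if ['X_i] lies in [P], and otherwise to the colon, which [P]
    contains by primality. *)
Lemma prime_filtration_sub L T (P : {pred R}) : prime_filtration L T ->
    prime_ideal P -> (forall p, monideal T p -> p \in P) ->
  exists2 S, L S & forall i, i \in S -> 'X_i \in P.
Proof.
move=> LT Pp; have Pi := ideal_prime_pred Pp.
elim: LT => {T} [S LS||T i upT _ IHD _ IHC] TP.
- exists S => // i iS; apply: TP; exact/varidealP/(etrans (varidealX _ _)).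
- by case: Pp => -[_ /negP[]]; apply: TP.
have [XP|XP] := boolP ('X_i \in P); [apply: IHD|apply: IHC] => p.
  rewrite -adjoin_monideal // => Tp.
  exact: (adjoin_min Pi TP XP Tp).
by rewrite -colon_monideal => /TP /Pp.2; rewrite (negPf XP).
Qed.

(** An associated prime of the middle term of a short exact sequence is associated to one of the
    outer terms. *)
Lemma prime_filtration_associated L T (P : {pred R}) f : prime_filtration L T ->
    prime_ideal P -> (forall g, g \in P <-> monideal T (g * f)) ->
  exists2 S, L S & P =i varideal S.
Proof.
move=> LT Pp; have [[_ /negP P1 _] PM] := Pp.
elim: LT f => {T} [S LS||T i upT _ IHD _ IHC] f Pf.
- exists S => // g; have [_ SM] := varideal_prime S.
  have fS : f \notin varideal S.
    by apply/negP => /varidealP fS; apply/P1/Pf; rewrite mul1r.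
  apply/idP/idP => [/Pf/varidealP/SM|/varidealP gS].
    by rewrite (negPf fS) orbF.
  apply/Pf; rewrite mulrC; apply: (idealM _ _ gS).
  exact/monideal_is_ideal/meets_upclosed.
- by case: P1; apply/Pf.
have Ti := monideal_is_ideal upT.
(* If a nonzero multiple [g * f] falls into the submodule generated by ['X_i], it still has
   annihilator [P] and is represented there by [a]. Otherwise [f] keeps its annihilator modulo
   ['X_i]. *)
have [[g [ngf [a gfa]]]|nex] := boolp.pselect (exists g,
    ~ monideal T (g * f) /\ adjoin (monideal T) 'X_i (g * f)).
  apply: (IHC a) => h; rewrite -colon_monideal /colon.
  have -> : monideal T ('X_i * (h * a)) <-> monideal T (h * g * f).
    have E : h * g * f = h * (g * f - a * 'X_i) + 'X_i * (h * a) by ring.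
    split=> [Tha|Thg]; first by rewrite E; apply: (idealD Ti) => //; apply: (idealM _ Ti).
    have -> : 'X_i * (h * a) = h * g * f - h * (g * f - a * 'X_i) by ring.
    by apply: (idealB Ti) => //; apply: (idealM _ Ti).
  split=> [hP|/Pf/PM/orP[//|/Pf//]].
  have -> : h * g * f = g * (h * f) by ring.
  by apply: (idealM _ Ti); apply/Pf.
apply: (IHD f) => h; rewrite -adjoin_monideal //; split=> [/Pf|Th].
  exact: adjoin_sub.
by apply/Pf; apply: boolp.contrapT => nTh; apply: nex; exists h.
Qed.

End MonomialIdeals.

Arguments varideal K {n} S.

(** * Algebraic dependence, dimension and depth *)

Section AlgebraicDependence.
Variables (K : fieldType) (n : nat).
Local Notation R := {mpoly K[n]}.
Implicit Types (s : seq R) (x y : R) (a : seq nat) (c : seq nat -> K).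

(* [x] is the value at [s] of a nonzero polynomial over [K], written with its
   lexicographically least monomial factored out. *)
Fixpoint lex_value s x : Prop :=
  if s is y :: s' then
    exists e (a b : R), x = y ^+ e * (a * y + b) /\ lex_value s' b
  else exists2 c : K, c != 0 & x = c%:MP.

Fixpoint box N l : seq (seq nat) :=
  if l is l'.+1 then [seq i :: a | i <- iota 0 N, a <- box N l'] else [:: [::]].

Lemma size_box N l : size (box N l) = (N ^ l)%N.
Proof. by elim: l => //= l IHl; rewrite size_allpairs size_iota IHl expnS. Qed.

Lemma uniq_box N l : uniq (box N l).
Proof.
elim: l => //= l IHl; apply: allpairs_uniq => //; first exact: iota_uniq.
by move=> [i a] [j b] _ _ /= [-> ->].
Qed.

Fixpoint monom s a : R :=
  match s, a with y :: s', i :: a' => y ^+ i * monom s' a' | _, _ => 1 end.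

Definition eval N c s : R := \sum_(a <- box N (size s)) c a *: monom s a.

Lemma eval_cons N c y s :
  eval N c (y :: s) = \sum_(0 <= i < N) y ^+ i * eval N (fun a => c (i :: a)) s.
Proof.
rewrite /eval /= big_allpairs_dep /= /index_iota subn0; apply: eq_bigr => i _.
by rewrite mulr_sumr; apply: eq_bigr => a _; rewrite scalerAr.
Qed.

Lemma eval_eq0 N c s : {in box N (size s), forall a, c a = 0} -> eval N c s = 0.
Proof. by move=> c0; rewrite /eval big_seq big1 // => a /c0->; rewrite scale0r. Qed.

(** Let [i] be the least exponent of the first element occurring with a nonzero coefficient: its
    power [i] factors out, and the later terms keep a further factor of that element. *)
Lemma lex_value_eval N c s a : a \in box N (size s) -> c a != 0 ->
  lex_value s (eval N c s).
Proof.
elim: s c a => [|y s IHs] c a /=.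
  rewrite inE => /eqP-> c0; exists (c [::]) => //.
  by rewrite /eval /= big_seq1 -mul_mpolyC mulr1.
case/allpairsP=> -[i0 a0] /= [iN0 aN0 ->] ca0.
pose nz i := has (fun b => c (i :: b) != 0) (box N (size s)).
have exi : exists i, nz i by exists i0; apply/hasP; exists a0.
case: (ex_minnP exi) => i /hasP[b bN cb] mini.
have ltiN : (i < N)%N.
  move: iN0; rewrite mem_iota => /andP[_]; apply: leq_ltn_trans.
  by apply: mini; apply/hasP; exists a0.
rewrite eval_cons (big_cat_nat _ (n := i)) ?(ltnW ltiN) //= big_nat big1 => [|j]; last first.
  case/andP=> _ ltji; rewrite eval_eq0 ?mulr0 // => b' b'N; apply/eqP/negPn/negP => cb'.
  have jnz : nz j by apply/hasP; exists b'.
  by have := mini j jnz; rewrite leqNgt ltji.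
rewrite add0r big_ltn //.
exists i, (\sum_(i.+1 <= j < N) y ^+ (j - i.+1) * eval N (fun a => c (j :: a)) s).
exists (eval N (fun a => c (i :: a)) s); split; last exact: IHs cb.
rewrite mulrDr addrC; congr (_ + _); rewrite mulr_suml mulr_sumr.
apply: eq_big_nat => j /andP[ltij _].
have -> : y ^+ j = y ^+ i * y * y ^+ (j - i.+1) by rewrite -exprSr -exprD subnKC.
by ring.
Qed.

Definition degree_le d (p : R) := forall m, m \in msupp p -> (mdeg m <= d)%N.

Lemma degree_leM d e p q : degree_le d p -> degree_le e q -> degree_le (d + e) (p * q).
Proof.
move=> pd qe m /msuppM_le/allpairsP[[m1 m2] /= [/pd m1d /qe m2e ->]].
by rewrite mdegD leq_add.
Qed.

Lemma degree_le1 : degree_le 0 1.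
Proof. by move=> m; rewrite msupp1 inE => /eqP->; rewrite mdeg0. Qed.

Lemma degree_leX d p e : degree_le d p -> degree_le (e * d) (p ^+ e).
Proof.
move=> pd; elim: e => [|e IHe]; first by rewrite expr0; apply: degree_le1.
by rewrite exprS mulSn; apply: degree_leM.
Qed.

Lemma degree_le_monom N d s a : (forall y, y \in s -> degree_le d y) ->
  a \in box N (size s) -> degree_le (size s * (N * d)) (monom s a).
Proof.
elim: s a => [|y s IHs] a sd /=; first by move=> _; apply: degree_le1.
case/allpairsP=> -[i a'] /= [iN aN ->]; rewrite mulSn; apply: degree_leM; last first.
  by apply: IHs => // z zs; apply: sd; rewrite inE zs orbT.
have yd := @degree_leX d y i (sd y (mem_head _ _)).
move=> m /yd /leq_trans; apply; rewrite leq_mul2r; apply/orP; right.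
by move: iN; rewrite mem_iota => /andP[_ /ltnW].
Qed.

Lemma degree_bound s : exists d, forall y, y \in s -> degree_le d y.
Proof.
elim: s => [|y s [d sd]]; first by exists 0%N.
exists (maxn d (msize y)) => z; rewrite inE => /orP[/eqP->|/sd zd] m.
  by move/msize_mdeg_lt => lt_m; rewrite leq_max (ltnW lt_m) orbT.
by move/zd => le_m; rewrite leq_max le_m.
Qed.

(** The left side is at most [(l * d).+1 ^ r * N ^ r], so it is enough that [N] exceed the constant
    [(l * d).+1 ^ r]. *)
Lemma exists_box_size d l r : (r < l)%N -> exists N, ((l * (N * d)).+1 ^ r < N ^ l)%N.
Proof.
move=> ltrl; pose N := ((l * d).+1 ^ r).+1; exists N.
have le1 : ((l * (N * d)).+1 <= (l * d).+1 * N)%N by nia.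
apply: (@leq_ltn_trans ((l * d).+1 ^ r * N ^ r)).
  rewrite -expnMn; case: (posnP r) => [r0|r_gt0]; last by rewrite leq_exp2r.
  by rewrite r0 !expn0.
apply: (@leq_trans (N ^ r.+1)); last by rewrite leq_pexp2l.
by rewrite expnS ltn_mul2r expn_gt0 /= ltnS leqnn.
Qed.

(** There are more products of powers of [s] than monomials outside [S] available to them, so the
    matrix of coefficients has a nonzero vector in its left kernel. *)
Lemma algebraic_dependence (S : {set 'I_n}) s : (#|~: S| < size s)%N ->
  exists2 x, lex_value s x & monideal (meets S) x.
Proof.
move=> lt_s; have [d sd] := degree_bound s.
have [N ltN] := exists_box_size d lt_s; pose M := (size s * (N * d)).+1.
pose F := {ffun {i | i \in ~: S} -> 'I_M}.
have cardF : #|F| = (M ^ #|~: S|)%N.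
  by rewrite card_ffun card_ord card_sig; congr (_ ^ _)%N; apply: eq_card => i; rewrite !inE.
pose mon (b : F) : 'X_{1..n} :=
  [multinom (if insub i is Some k then b k : nat else 0%N) | i < n].
pose B := box N (size s).
pose Mx : 'M[K]_(size B, #|F|) := \matrix_(i, j) (monom s (nth [::] B i))@_(mon (enum_val j)).
have ker_nz : kermx Mx != 0.
  rewrite -mxrank_eq0 mxrank_ker -lt0n subn_gt0.
  by apply: leq_ltn_trans (rank_leq_col _) _; rewrite cardF /B size_box.
have /rowV0Pn[v /sub_kermxP vMx v_nz] := ker_nz.
pose c a := if insub (index a B) is Some i then v 0 i else 0.
have cE (i : 'I_(size B)) : c (nth [::] B i) = v 0 i by rewrite /c index_uniq ?uniq_box // valK.
have evE : eval N c s = \sum_(i < size B) v 0 i *: monom s (nth [::] B i).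
  rewrite /eval -/B (big_nth [::]) big_mkord; apply: eq_bigr => i _.
  by rewrite cE.
exists (eval N c s).
  have [i vi] : exists i, v 0 i != 0.
    apply: boolp.contrapT => nv; case/negP: v_nz; apply/eqP/rowP => i; rewrite mxE.
    by apply/eqP/negPn/negP => vi; apply: nv; exists i.
  by apply: (@lex_value_eval N c s (nth [::] B i)); rewrite ?cE // mem_nth.
move=> m; apply: contraTT => Sm; rewrite -mcoeff_eq0.
(* Degree reasons exclude monomials of degree at least [M]; those of smaller degree avoiding [S]
   index columns of [Mx]. *)
have [lt_m|ge_m] := ltnP (mdeg m) M; last first.
  rewrite mcoeff_eq0; apply/negP => /msupp_sum_le /flattenP[_ /mapP[a aB ->]].
  move/msuppZ_le => ma; move: ge_m; rewrite /M ltnNge.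
  by rewrite (degree_le_monom sd _ ma) //; move: aB; rewrite filter_predT.
have ltmM i : (m i < M)%N.
  by apply: leq_ltn_trans lt_m; rewrite mdegE (bigD1 i) //= leq_addr.
pose b : F := [ffun k => Ordinal (ltmM (val k))].
have mb : m = mon b.
  apply/mnmP => i; rewrite mnmE; case: insubP => [k _ <-|]; first by rewrite ffunE.
  rewrite inE negbK => iS; apply/eqP; rewrite -leqn0 leqNgt; apply: contra Sm => mi.
  by apply/meetsP; exists i.
have := congr1 (fun u : 'rV_ _ => u 0 (enum_rank b)) vMx.
rewrite !mxE evE raddf_sum /= => E; rewrite -[X in _ == X]E; apply/eqP.
by apply: eq_bigr => i _; rewrite mcoeffZ !mxE enum_rankK -mb.
Qed.

(** If [x] were in [Q j], the power of [y j] would cancel by primality; modulo [Q j.+1] the term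
    [a * y j] vanishes, leaving [b] in [Q j.+1], against the induction hypothesis. *)
Lemma lex_value_chain (Q : nat -> {pred R}) (y : nat -> R) j l x :
    (forall i, (i <= j + l)%N -> prime_ideal (Q i)) ->
    (forall i, (i < j + l)%N -> {subset Q i <= Q i.+1}) ->
    (forall i, (i < j + l)%N -> y i \in Q i.+1 /\ y i \notin Q i) ->
  lex_value (map y (iota j l)) x -> x \notin Q j.
Proof.
elim: l j x => [|l IHl] j x Qp Qs Qy /=.
  move=> [c c_nz ->]; apply/negP => cQ.
  have [[_ /negP nQ1 _] _] := Qp j (leq_addr _ _); apply: nQ1.
  have -> : 1 = c^-1%:MP * c%:MP :> R by rewrite -mpolyCM mulVf.
  by apply: (idealM _ (ideal_prime_pred (Qp j (leq_addr _ _)))).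
move=> [e [a [b [-> bv]]]]; apply/negP.
have ltj : (j < j + l.+1)%N by rewrite addnS ltnS leq_addr.
have [yQ' yQ] := Qy j ltj; have [_ QM] := Qp j (ltnW ltj).
have QjX : y j ^+ e * (a * y j + b) \in Q j -> a * y j + b \in Q j.
  by elim: e => [|e IHe]; rewrite ?mul1r // exprS -mulrA => /QM; rewrite (negPf yQ).
move/QjX/(Qs _ ltj) => abQ.
have /negP[] : b \notin Q j.+1 by apply: IHl bv => i; rewrite addSnnS; auto.
have -> : b = (a * y j + b) - a * y j by ring.
have Qi := ideal_prime_pred (Qp _ ltj).
by apply: (idealB Qi) => //; apply: (idealM _ Qi).
Qed.

(** Pick [y i] in [Q i.+1] outside [Q i]. If there were too many, a dependence modulo the variables
    in [S] would lie in [Q 0], contradicting [lex_value_chain]. *)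
Lemma dim_varideal (S : {set 'I_n}) (Q : nat -> {pred R}) l :
    (forall i, (i <= l)%N -> prime_ideal (Q i)) ->
    (forall i, (i < l)%N -> {subset Q i <= Q i.+1} /\ ~ {subset Q i.+1 <= Q i}) ->
    {subset varideal K S <= Q 0%N} ->
  (l <= #|~: S|)%N.
Proof.
move=> Qp Qs SQ; rewrite leqNgt; apply/negP => ltl.
have [y yE] : exists y : nat -> R, forall i, (i < l)%N -> y i \in Q i.+1 /\ y i \notin Q i.
  suff /boolp.choice[y yE] : forall i, exists z, (i < l)%N -> z \in Q i.+1 /\ z \notin Q i.
    by exists y.
  move=> i.
  have [lti|] := boolP (i < l)%N; last by exists 0.
  have [_ nsub] := Qs i lti; apply: boolp.contrapT => ny; apply: nsub => z zQ.
  by apply/negPn/negP => nz; apply: ny; exists z.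
have [|x xv xS] := @algebraic_dependence S (map y (iota 0 l)).
  by rewrite size_map size_iota.
have /negP[] := @lex_value_chain Q y 0 l x Qp (fun i lti => (Qs i lti).1) yE xv.
by apply: SQ; apply/varidealP.
Qed.

Lemma varideal_chain (A B : {set 'I_n}) : A \subset B ->
  exists C : nat -> {pred R}, [/\ C 0%N =i varideal K A, C #|B :\: A| =i varideal K B,
    forall i, prime_ideal (C i)
  & forall i, (i < #|B :\: A|)%N -> {subset C i <= C i.+1} /\ ~ {subset C i.+1 <= C i}].
Proof.
move=> sAB; pose e := enum (B :\: A).
pose D i := A :|: [set x in take i e].
exists (fun i => varideal K (D i)); split.
- move=> p; suff -> : D 0%N = A by [].
  by apply/setP => x; rewrite !inE take0 orbF.
- move=> p; suff -> : D #|B :\: A| = B by [].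
  apply/setP => x; rewrite !inE cardE take_size mem_enum inE.
  by case: (boolP (x \in A)) => // /(subsetP sAB)->.
- by move=> i; apply: varideal_prime.
move=> i; rewrite cardE -/e => lti; have x0 : 'I_n := tnth (in_tuple e) (Ordinal lti).
have De : D i.+1 = nth x0 e i |: D i.
  by apply/setP => x; rewrite !inE (take_nth x0) // mem_rcons inE orbCA.
split=> [p|sD].
  apply: (@varideal_min _ _ _ (fun q => q \in varideal K (D i.+1))) => [|j jD].
    exact/ideal_prime_pred/varideal_prime.
  by rewrite varidealX De !inE; apply/orP; right; move: jD; rewrite !inE.
have := sD 'X_(nth x0 e i); rewrite !varidealX De setU11 => /(_ isT).
have ee : nth x0 e i \in e by apply: mem_nth.
rewrite !inE => /orP[xA|]; first by move: ee; rewrite mem_enum inE xA.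
by rewrite in_take_leq ?(ltnW lti) // index_uniq ?enum_uniq // ltnn.
Qed.

(** For the upper bound, a chain ending at this prime is prolonged by the remaining variables, and
    its total length is at most [n]. *)
Lemma varideal_height (S : {set 'I_n}) : has_height (varideal K S) #|S|.
Proof.
split.
  have [C [C0 CS Cp Cs]] := varideal_chain (sub0set S); rewrite setD0 in CS Cs.
  rewrite -[#|S|]add0n; apply: (prime_chain_cat _ C0 CS) => //.
  by exists (fun=> varideal K set0); split=> // i _; apply: varideal_prime.
move=> l Sl; have [C [C0 CT Cp Cs]] := varideal_chain (subsetT S).
have [|Q [Qp Qs QT]] := prime_chain_cat Sl C0 CT _ Cs; first by move=> i _; apply: Cp.
have := @dim_varideal set0 Q _ Qp Qs.
rewrite setC0 setTD cardsT -(cardsC S) leq_add2r; apply=> p pE.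
have -> : p = 0.
  apply/eqP; rewrite -msupp_eq0; case Ep: (msupp p) => [//|m r].
  have /varidealP/(_ m) := pE; rewrite Ep mem_head => /(_ isT)/meetsP[i].
  by rewrite inE.
by case: (Qp 0%N (leq0n _)) => -[].
Qed.

(** Regularity cancels the power of [y]; after adjoining [y] the term [a * y] drops out and [b]
    takes over. *)
Lemma lex_value_cancel (J : R -> Prop) s x f : is_ideal J -> weakly_regular J s ->
  lex_value s x -> J (x * f) -> adjoin_seq J s f.
Proof.
elim: s J x => [|y s IHs] J x Ji /=.
  move=> _ [c c_nz ->] Jf; rewrite /adjoin_seq /=.
  have -> : f = c^-1%:MP * (c%:MP * f) by rewrite mulrA -mpolyCM mulVf // mul1r.
  exact: idealM.
move=> [regy wreg] [e [a [b [-> bv]]]].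
have regX z : J (y ^+ e * z) -> J z.
  by elim: e => [|e IHe]; rewrite ?mul1r // exprS -mulrA => /regy.
rewrite -mulrA => /regX Jf; apply: (IHs _ b) => //; first exact: adjoin_ideal.
exists (- a * f); have -> : b * f - - a * f * y = (a * y + b) * f by ring.
by [].
Qed.

(* Raising the sequence to the power [t = msize f] and cancelling along a
   relation modulo the annihilated variables puts [f] in
   [T + (X_1, .., X_n)^t], which for a monomial ideal forces [f] into [T]. *)
Lemma depth_le_varideal (T : 'X_{1..n} -> bool) (S : {set 'I_n}) (f : R) s :
    upclosed T ->
    ~ monideal T f -> (forall i, i \in S -> monideal T ('X_i * f)) ->
    weakly_regular (@monideal K n T) s -> (forall y, y \in s -> y \in varideal K setT) ->
  (size s <= #|~: S|)%N.
Proof.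
move=> upT nTf STf wreg sm; rewrite leqNgt; apply/negP => lts.
have Ti := monideal_is_ideal K upT; pose t := msize f.
have wregX := weakly_regular_exp t Ti wreg.
have [|x xv xS] := @algebraic_dependence S [seq y ^+ t | y <- s]; first by rewrite size_map.
have Jxf : monideal T (x * f).
  rewrite mulrC; apply: (@varideal_min _ _ S (colon (monideal T) f)) => [|i iS|].
  - exact: colon_ideal.
  - by rewrite /colon mulrC; apply: STf.
  - exact/varidealP.
have fv := lex_value_cancel Ti wregX xv Jxf.
pose T' m := T m || (t <= mdeg m)%N.
have upT' : upclosed T'.
  move=> m m' /orP[/upT|le_t]; first by move=> T1; rewrite /T' T1.
  by rewrite /T' mdegD (leq_trans le_t) ?leq_addr ?orbT.
apply: nTf => m mf; suff /orP[//|] : T' m.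
  by rewrite leqNgt msize_mdeg_lt.
apply: (adjoin_seq_min (monideal_is_ideal K upT') _ _ fv) mf => [p Tp m'|z].
  by rewrite /T' => /Tp->.
case/mapP=> y /sm /varidealP ym ->.
suff yX e m' : m' \in msupp (y ^+ e) -> (e <= mdeg m')%N.
  by move=> m' /yX; rewrite /T' => ->; rewrite orbT.
elim: e m' => // e IHe m'; rewrite exprS.
case/msuppM_le/allpairsP=> -[m1 m2] /= [/ym/meetsP[i _ m1i] /IHe m2e ->].
rewrite mdegD -add1n leq_add //.
by rewrite mdegE (bigD1 i) //= (leq_trans m1i) // leq_addr.
Qed.

End AlgebraicDependence.

(** * Regular sequences of univariate polynomials *)

Section Evaluation.
Variables (K : fieldType) (n : nat).
Local Notation R := {mpoly K[n]}.
Implicit Types (f g : {poly K}) (S : {set 'I_n}).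

Lemma mpoly_rmorph_eq (B : comNzRingType) (phi psi : {rmorphism R -> B}) :
  (forall c, phi c%:MP = psi c%:MP) -> (forall i, phi 'X_i = psi 'X_i) -> phi =1 psi.
Proof.
move=> eqC eqX p; rewrite [p]mpolyE !rmorph_sum; apply: eq_bigr => m _.
rewrite -mul_mpolyC !rmorphM eqC; congr (_ * _).
rewrite mpolyXE_id !rmorph_prod; apply: eq_bigr => i _.
by rewrite !rmorphXn eqX.
Qed.

Definition peval f (u : R) : R := (map_poly (@mpolyC n K) f).[u].

Lemma pevalB f (J : R -> Prop) u v : is_ideal J -> J (u - v) ->
  J (peval f u) -> J (peval f v).
Proof.
move=> Ji Juv Jf; rewrite -[peval f v](subKr (peval f u)); apply: idealB => //.
rewrite /peval !horner_coef -sumrB; apply: ideal_sum => // i _.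
by rewrite -mulrBr subrXX mulrCA mulrC; apply: idealM => //; rewrite mulrC; apply: idealM.
Qed.

Lemma peval_kill S f u : peval f u \mPo kill K S = peval f (u \mPo kill K S).
Proof.
rewrite /peval -horner_map -map_poly_comp; congr (_.[_]).
by apply: eq_map_poly => c /=; rewrite comp_mpolyC.
Qed.

Lemma killX S i : 'X_i \mPo kill K S = if i \in S then 0 else 'X_i.
Proof. by rewrite comp_mpolyXU -tnth_nth tnth_mktuple. Qed.

Lemma kill_idem S x : (x \mPo kill K S) \mPo kill K S = x \mPo kill K S.
Proof.
apply: (mpoly_rmorph_eq (phi := comp_mpoly (kill K S) \o comp_mpoly (kill K S))
                        (psi := comp_mpoly (kill K S))) => [c|i] /=.
  by rewrite !comp_mpolyC.
by rewrite killX; case: ifP => iS; rewrite ?comp_mpoly0 // killX iS.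
Qed.

Section Separate.
Variable p : 'I_n.

(** Reads a polynomial as univariate in ['X_p], with coefficients in the other variables kept inside
    [R], so that univariate division applies. *)
Definition separate : {rmorphism R -> {poly R}} :=
  mmap (polyC \o @mpolyC n K) (fun i => if i == p then 'X else ('X_i)%:P).

Lemma separateC c : separate c%:MP = c%:MP%:P.
Proof. by rewrite /separate /= mmapC. Qed.

Lemma separateX i : separate 'X_i = if i == p then 'X else ('X_i)%:P.
Proof. by rewrite /separate /= mmapX mmap1U. Qed.

Lemma separateK x : (separate x).['X_p] = x.
Proof.
apply: (mpoly_rmorph_eq (phi := horner_eval 'X_p \o separate) (psi := idfun)) => [c|i] /=.
  by rewrite separateC /horner_eval hornerC.
by rewrite separateX /horner_eval; case: eqP => [->|_]; rewrite ?hornerX ?hornerC.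
Qed.

Lemma separate_peval f q : separate (peval f 'X_q) =
  if q == p then map_poly (@mpolyC n K) f else (peval f 'X_q)%:P.
Proof.
rewrite /peval -horner_map -map_poly_comp /= separateX.
have -> : map_poly (separate \o @mpolyC n K) f = map_poly polyC (map_poly (@mpolyC n K) f).
  by rewrite -map_poly_comp; apply: eq_map_poly => c /=; rewrite separateC.
case: ifP => _; last by rewrite horner_map.
by rewrite -[RHS]comp_polyXr.
Qed.

End Separate.

Lemma peval_neq0 f p : f != 0 -> peval f 'X_p != 0.
Proof.
move=> f_nz; apply/eqP => /(congr1 (separate p)); rewrite separate_peval eqxx rmorph0.
by move/eqP; rewrite map_poly_eq0_id0 ?(negPf f_nz) // mpolyC_eq0 lead_coef_eq0.
Qed.

(** Modulo the variables in [S], the factor becomes [f] at ['X_p], a nonzero element of a domain. *)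
Lemma peval_nzd S p f u x : p \notin S -> f != 0 -> u \mPo kill K S = 'X_p ->
  monideal (meets S) (peval f u * x) -> monideal (meets S) x.
Proof.
move=> pS f_nz uE /comp_kill_eq0; rewrite rmorphM /= peval_kill uE => /eqP.
by rewrite mulf_eq0 (negPf (peval_neq0 _ f_nz)) => /eqP/comp_kill_eq0.
Qed.

(* Modulo [X_i], [i \in S], this says that [f(X_p)] and [g(X_q)] are coprime;
   divide with remainder by [f], whose leading coefficient is a unit. *)
Lemma peval_regular S p q f g u v : p \notin S -> q \notin S -> p != q ->
    f != 0 -> g != 0 -> u \mPo kill K S = 'X_p -> v \mPo kill K S = 'X_q ->
  weakly_regular (monideal (meets S)) [:: peval f u; peval g v].
Proof.
move=> pS qS npq f_nz g_nz uE vE; split; first by move=> x; apply: (peval_nzd pS f_nz uE).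
split=> // x [a /comp_kill_eq0].
rewrite rmorphB !rmorphM /= !peval_kill uE vE.
set x' := x \mPo _; set a' := a \mPo _ => /eqP; rewrite subr_eq0 => /eqP E.
pose F := map_poly (@mpolyC n K) f; pose G := peval g 'X_q.
have {}E : separate p x' * G%:P = separate p a' * F.
  have := congr1 (separate p) E; rewrite !rmorphM !separate_peval eqxx.
  by rewrite eq_sym (negPf npq) mulrC.
have lF : lead_coef F \is a GRing.unit.
  rewrite lead_coef_map_id0 ?mpolyC0 ?mpolyC_eq0 ?lead_coef_eq0 //.
  apply/unitrP; exists (lead_coef f)^-1%:MP.
  by rewrite -!mpolyCM mulVf ?mulfV ?lead_coef_eq0.
have F_nz : F != 0 by rewrite -lead_coef_eq0; apply: contraTneq lF => ->; rewrite unitr0.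
have dE := Pdiv.IdomainUnit.divp_eq lF (separate p x').
set Q := _ %/ _ in dE; set r := _ %% _ in dE.
have ltr : (size r < size F)%N by rewrite Pdiv.Idomain.ltn_modp.
pose d : {poly R} := separate p a' - Q * G%:P.
have rE : r * G%:P = d * F.
  by rewrite /d mulrBl -E dE; ring.
(* Compare degrees in [r * G%:P = d * F]: the left side has degree below that of [F], so [d] is
   zero. *)
have r0 : r = 0.
  apply/eqP; have G_nz : G%:P != 0 by rewrite polyC_eq0 peval_neq0.
  suff: r * G%:P == 0 by rewrite mulf_eq0 (negPf G_nz) orbF.
  rewrite rE; apply/eqP; have [->|d_nz] := eqVneq d 0.
    by rewrite mul0r.
  have szr : (size (r * G%:P)%R <= size r)%N by rewrite mulrC mul_polyC size_scale_leq.
  have := leq_ltn_trans szr ltr; rewrite rE size_mul //.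
  move: d_nz; rewrite -size_poly_gt0; case: (size d) => // k _.
  by rewrite addSn /= ltnNge leq_addl.
have x'E : x' = Q.['X_p] * peval f 'X_p.
  by rewrite -[LHS](separateK p) dE r0 addr0 hornerM.
exists Q.['X_p]; apply/comp_kill_eq0.
rewrite rmorphB rmorphM /= peval_kill uE -[x \mPo _]kill_idem -/x' x'E.
by rewrite rmorphM /= peval_kill killX (negPf pS) subrr.
Qed.

(** Modulo the variables in [S] only ['X_p] and ['X_q] remain, so [M] pulls back to
    [{poly {poly K}}], where it meets the constants. *)
Lemma maximal_ideal_peval (M : R -> Prop) S p q : is_ideal M -> ~ M 1 ->
    (forall x, ~ M x -> exists y, M (1 - x * y)) ->
    (forall i, i \in S -> M 'X_i) -> (forall i, [|| i \in S, i == p | i == q]) ->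
  exists2 f, f != 0 & M (peval f 'X_p).
Proof.
move=> Mi M1 Minv SM Spq.
pose ev1 : {rmorphism {poly K} -> R} := horner_eval 'X_p \o map_poly (@mpolyC n K).
pose ev : {rmorphism {poly {poly K}} -> R} := horner_eval 'X_q \o map_poly ev1.
pose th : {rmorphism R -> {poly {poly K}}} :=
  mmap (polyC \o polyC) (fun i => if i == p then 'X%:P else if i == q then 'X else 0).
have evC f : ev f%:P = peval f 'X_p.
  by rewrite /ev /= map_polyC /horner_eval hornerC.
(* [ev] is surjective modulo the variables in [S], with [th] providing preimages. *)
have modM x : M (x - ev (th x)).
  have: x - ev (th x) \in varideal K S.
    apply/varidealP/comp_kill_eq0; rewrite rmorphB /=; apply/eqP; rewrite subr_eq0; apply/eqP.
    apply: (mpoly_rmorph_eq (phi := comp_mpoly (kill K S))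
              (psi := comp_mpoly (kill K S) \o (ev \o th))) => [c|i] /=.
      rewrite mmapC /= map_polyC /= /horner_eval hornerC.
      by rewrite map_polyC /= hornerC !comp_mpolyC.
    rewrite mmapX mmap1U; case: eqP => [->|/eqP ip].
      rewrite map_polyC /= /horner_eval hornerC.
      by rewrite map_polyX hornerX.
    case: eqP => [->|/eqP iq]; first by rewrite map_polyX /horner_eval hornerX.
    have := Spq i; rewrite (negPf ip) (negPf iq) !orbF => iS.
    by rewrite rmorph0 /horner_eval horner0 killX iS comp_mpoly0.
  by apply: varideal_min.
pose J := fun F => M (ev F).
have Ji : is_ideal J.
  split; first by rewrite /J rmorph0; case: Mi.
  by move=> a F G; rewrite /J rmorphD rmorphM; apply: Mi.2.
have [||f f_nz Jf] := @maximal_ideal_meets_constants K J Ji.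
- by rewrite /J rmorph1.
- move=> F /Minv[y My]; exists (th y); rewrite /J rmorphB rmorphM rmorph1.
  have -> : 1 - ev F * ev (th y) = 1 - ev F * y + ev F * (y - ev (th y)) by ring.
  by apply: idealD => //; apply: idealM.
by exists f => //; rewrite -evC.
Qed.

End Evaluation.

(** * Associated primes and edge ideals *)

Section AssociatedVarideals.
Variables (K : fieldType) (n : nat).
Local Notation R := {mpoly K[n]}.
Implicit Types (T : 'X_{1..n} -> bool) (S : {set 'I_n}) (m : 'X_{1..n}).

(** These conditions say that the class of ['X_[m]] modulo the ideal of [T] has annihilator exactly
    [varideal K S], which is thus an associated prime. *)
Definition socle_monomial T S m :=
  [/\ ~~ T m, forall i, i \in S -> T (m + U_(i))%MM
    & forall m', ~~ meets S m' -> T (m + m')%MM -> T m].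

(* Increase exponents inside [S] as long as the monomial stays outside [T]. *)
Lemma exists_socle_monomial T S m0 N : upclosed T -> ~~ T m0 ->
    (forall i, i \in S -> T (m0 + U_(i) *+ N)%MM) ->
    (forall m m', (forall j, j \notin S -> m j = m0 j) -> ~~ meets S m' ->
       T (m + m')%MM -> T m) ->
  exists m, socle_monomial T S m.
Proof.
move=> upT Tm0 TN stab.
pose good k := boolp.asbool (exists d : 'X_{1..n}, [/\ forall j, j \notin S -> d j = 0%N,
  ~~ T (m0 + d)%MM & mdeg d = k]).
have ex_good : exists k, good k.
  exists 0%N; apply/boolp.asboolP; exists 0%MM.
  by split=> [j _||]; rewrite ?mnm0E ?addm0 ?mdeg0.
(* An exponent of [d] above [N] at some [i] in [S] would put [m0 + d] in [T]. *)
have bound k : good k -> (k <= n * N)%N.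
  move/boolp.asboolP=> [d [dS Td <-]]; rewrite mdegE.
  rewrite -[n in (n * N)%N]card_ord -sum_nat_const; apply: leq_sum => i _.
  have [iS|/dS->//] := boolP (i \in S); rewrite leqNgt; apply: contra Td => ltN.
  have -> : d = (U_(i) *+ N + (d - U_(i) *+ N))%MM.
    rewrite addmC submK //; apply/mnm_lepP => j; rewrite mulmnE mnm1E.
    by case: eqP => [<-|_]; rewrite ?mul1n ?(ltnW ltN).
  by rewrite addmA; apply: upT; apply: TN.
case: (ex_maxnP ex_good bound) => k /boolp.asboolP[d [dS Td <-]] maxd.
exists (m0 + d)%MM; split=> // [i iS|m' Sm' Tm'].
  apply/negPn/negP => Ti; have: good (mdeg (d + U_(i))%MM).
    apply/boolp.asboolP; exists (d + U_(i))%MM; split=> //; last by rewrite addmA.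
    move=> j jS; rewrite mnmDE dS // mnm1E; case: eqP => // ij.
    by rewrite -ij iS in jS.
  by move/maxd; rewrite mdegD mdeg1 addn1 ltnn.
by apply: (stab _ m') => // j jS; rewrite mnmDE dS ?addn0.
Qed.

Lemma socle_monomial_annihilator T S m (g : R) : upclosed T -> socle_monomial T S m ->
  g \in varideal K S <-> monideal T (g * 'X_[m]).
Proof.
move=> upT [Tm TS stab]; split=> [gS|Tg].
  rewrite mulrC; apply: (@varideal_min _ _ S (colon (monideal T) 'X_[m])) => // [|i iS].
    exact/colon_ideal/monideal_is_ideal.
  by rewrite /colon -mpolyXD; apply/monidealX/TS.
apply/varidealP => m' m'g; apply: contraR Tm => Sm'; apply: (stab _ Sm').
by apply: Tg; rewrite (perm_mem (msuppMX _ _)) map_f.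
Qed.

End AssociatedVarideals.

(** * Edge ideals as monomial ideals, and minimal vertex covers *)

Section EdgeMonomials.
Variables (n : nat) (D : weighted_oriented_graph 'I_n).
Implicit Types (S : {set 'I_n}) (m : 'X_{1..n}).

Definition edge_divides m := [exists i, exists j,
  [&& edge D i j, (0 < m i)%N & (weight D j <= m j)%N]].

Lemma edge_dividesP m : reflect
  (exists i j, [/\ edge D i j, (0 < m i)%N & (weight D j <= m j)%N]) (edge_divides m).
Proof.
apply: (iffP existsP) => [[i /existsP[j /and3P[? ? ?]]]|[i [j [? ? ?]]]].
  by exists i, j.
by exists i; apply/existsP; exists j; apply/and3P.
Qed.

Lemma edge_divides_upclosed : upclosed edge_divides.
Proof.
move=> m m' /edge_dividesP[i [j [ij mi mj]]]; apply/edge_dividesP; exists i, j.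
by split; rewrite // mnmDE ?addn_gt0 ?mi // (leq_trans mj) ?leq_addr.
Qed.

Lemma edge_idealE (K : fieldType) (p : {mpoly K[n]}) :
  p \in edge_ideal K D <-> monideal edge_divides p.
Proof.
have [I0 _ ID] := @edge_ideal_closed K n D.
have Ii : is_ideal (fun p => p \in edge_ideal K D) by split=> // a u v; apply: ID.
split; last first.
  apply: (@monideal_min _ _ _ (fun p => p \in edge_ideal K D)) => // m.
  case/edge_dividesP=> i [j [ij mi mj]].
  have neq_ij : i != j by apply: contraTneq ij => ->; rewrite edge_irreflexive.
  have le_m : (U_(i) + U_(j) *+ weight D j <= m)%MM.
    apply/mnm_lepP => l; rewrite mnmDE mulmnE !mnm1E.
    case: (eqVneq i l) => [<-|il]; first by rewrite eq_sym (negPf neq_ij) mi.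
    by case: eqP => [<-|_]; rewrite ?mul1n ?mul0n.
  rewrite -(submK le_m) mpolyXD; apply: (idealM _ Ii).
  apply/boolp.asboolP; exists 1%N, (fun=> 1), (fun=> 'X_[U_(i) + U_(j) *+ weight D j]).
  split; last by rewrite big_ord1 mul1r.
  move=> _; apply/existsP; exists i; apply/existsP; exists j; rewrite ij /=.
  by rewrite mpolyXD -mpolyXn.
move=> /boolp.asboolP[l [c [g [gE ->]]]].
have Ti := monideal_is_ideal K edge_divides_upclosed.
apply: (ideal_sum Ti) => a _; apply: (idealM _ Ti).
have /existsP[i /existsP[j /andP[ij /eqP->]]] := gE a.
rewrite mpolyXn -mpolyXD; apply/monidealX/edge_dividesP; exists i, j.
by rewrite !mnmDE !mulmnE !mnm1E !eqxx mul1n leq_addl.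
Qed.

(** An exponent this large satisfies every divisibility condition on its variable, so raising it
    further changes nothing. *)
Definition weight_bound := (\sum_j weight D j).+1.

Lemma weight_le_bound j : (weight D j <= weight_bound)%N.
Proof. by rewrite /weight_bound (bigD1 j) //= leqW // leq_addr. Qed.

Lemma edge_divides_stable S m m' : (forall j, j \notin S -> m j = weight_bound) ->
  ~~ meets S m' -> edge_divides (m + m') -> edge_divides m.
Proof.
move=> mN Sm' /edge_dividesP[i [j [ij mi mj]]]; apply/edge_dividesP; exists i, j.
have m'0 l : l \in S -> m' l = 0%N.
  move=> lS; apply/eqP; rewrite -leqn0 leqNgt; apply: contra Sm' => m'l.
  by apply/meetsP; exists l.
split=> //.
  by have [/m'0 E|/mN->//] := boolP (i \in S); rewrite mnmDE E addn0 in mi.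
have [/m'0 E|/mN->] := boolP (j \in S); last exact: weight_le_bound.
by rewrite mnmDE E addn0 in mj.
Qed.

Lemma exists_edge_socle S m0 : ~~ edge_divides m0 ->
    (forall i, i \in S -> edge_divides (m0 + U_(i) *+ weight_bound)) ->
    (forall j, j \notin S -> m0 j = weight_bound) ->
  exists m, socle_monomial edge_divides S m.
Proof.
move=> Tm0 TN m0N; apply: (exists_socle_monomial edge_divides_upclosed Tm0 TN).
by move=> m m' mm0; apply: edge_divides_stable => j jS; rewrite mm0 // m0N.
Qed.

(** Start from the monomial with large exponents outside [S] and none inside. No edge divides it
    because [S] is a cover; by minimality, each vertex of [S] has a neighbour outside, so raising
    its exponent enters the ideal. *)
Lemma minimal_cover_socle S :
    (forall i j, edge D i j -> (i \in S) || (j \in S)) ->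
    (forall i, i \in S -> exists2 j, edge D i j || edge D j i & j \notin S) ->
  exists m, socle_monomial edge_divides S m.
Proof.
move=> cover min; pose m0 : 'X_{1..n} :=
  [multinom (if i \in S then 0 else weight_bound)%N | i < n].
have m0E i : m0 i = (if i \in S then 0 else weight_bound)%N by rewrite mnmE.
apply: (@exists_edge_socle S m0) => [|i iS|j /negPf jS]; last by rewrite m0E jS.
  apply/edge_dividesP => -[i [j [/cover/orP[]]]]; rewrite !m0E => -> //.
  by move=> _; rewrite leqNgt weight_gt0.
have [j ij jS] := min i iS.
have neq : (i == j) = false by apply: contraTF jS => /eqP<-; rewrite iS.
apply/edge_dividesP; case/orP: ij => ij; [exists i, j|exists j, i]; split=> //;
  by rewrite mnmDE mulmnE mnm1E m0E ?iS ?(negPf jS) ?eqxx ?neq ?mul1n ?mul0n ?addn0 ?add0n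
    ?weight_le_bound.
Qed.

End EdgeMonomials.

(** * Criteria for unmixedness and the Cohen-Macaulay property *)

Section Criteria.
Variables (K : fieldType) (n : nat) (D : weighted_oriented_graph 'I_n).
Local Notation R := {mpoly K[n]}.
Local Notation T := (edge_divides D).

Definition edge_pi : {rmorphism R -> edge_ring K D} :=
  \pi_{ideal_quot (edge_ideal K D)}%qT.

Lemma edge_pi_surj a : exists x, edge_pi x = a.
Proof. by exists (repr a); apply: reprK. Qed.

Lemma edge_pi_ker x : edge_pi x = 0 <-> monideal T x.
Proof.
rewrite -edge_idealE -[x in x \in _]subr0 Quotient.idealrBE; split=> [|/eqP].
  by rewrite -(rmorph0 edge_pi) => ->.
by rewrite -(rmorph0 edge_pi).
Qed.

Lemma socle_varideal_sub S m : socle_monomial T S m ->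
  forall x : R, monideal T x -> x \in varideal K S.
Proof.
move=> Sm x Tx; have upT := edge_divides_upclosed (D := D).
apply/(socle_monomial_annihilator _ upT Sm); rewrite mulrC.
exact: (idealM _ (monideal_is_ideal K upT) Tx).
Qed.

Lemma not_unmixed_edge_ideal S B m m' : socle_monomial T S m -> socle_monomial T B m' ->
  (#|B| < #|S|)%N -> ~ unmixed (edge_ideal K D).
Proof.
move=> Sm Bm ltBS [h hE].
have height S0 m0 : socle_monomial T S0 m0 -> h = #|S0|.
  move=> Sm0; have [] := hE (varideal K S0).
    split; first exact: varideal_prime.
    exists 'X_[m0] => g; apply/idP/idP.
      by move/(socle_monomial_annihilator _ (@edge_divides_upclosed _ D) Sm0)/edge_idealE.
    by move/edge_idealE/(socle_monomial_annihilator _ (@edge_divides_upclosed _ D) Sm0).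
  have [c1 max1] := varideal_height K S0 => c2 max2.
  by apply/eqP; rewrite eqn_leq max1 //= max2.
by move: ltBS; rewrite -(height S m) // -(height B m') // ltnn.
Qed.

Lemma not_cohen_macaulay_edge_ring S B m m' : socle_monomial T S m ->
    socle_monomial T B m' -> (#|B| < #|S|)%N ->
  ~ cohen_macaulay (edge_ring K D).
Proof.
move=> Sm Bm ltBS CM; have upT := edge_divides_upclosed (D := D).
pose M := varideal K (setT : {set 'I_n}).
have Mp : prime_ideal M := varideal_prime K setT.
have Mi := ideal_prime_pred Mp.
have BM p : p \in varideal K B -> p \in M.
  by apply: (@varideal_min _ _ _ (fun p => p \in M)) => // i _; rewrite varidealX inE.
have TB := socle_varideal_sub Bm; have TM x Tx := BM x (TB x Tx).
have maxM : maximal_ideal (image_ideal edge_pi M).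
  apply: (maximal_image edge_pi_surj edge_pi_ker) => //; first by case: Mp => -[].
  (* A polynomial outside the ideal of the origin is congruent to its nonzero constant term. *)
  move=> x xM; have c_nz : x@_0%MM != 0.
    apply: contra xM; rewrite mcoeff_eq0 => x0; apply/varidealP => l lx.
    have l_nz : l != 0%MM by apply: contra x0 => /eqP <-.
    apply/meetsP; have [i li|l0] := pickP (fun i => 0 < l i)%N; first by exists i.
    case/eqP: l_nz; apply/mnmP => i; rewrite mnm0E; apply/eqP.
    by rewrite -leqn0 leqNgt l0.
  exists (x@_0)^-1%:MP; apply/varidealP/comp_kill_eq0.
  have cE : x \mPo kill K setT = (x@_0)%:MP.
    have: x - (x@_0)%:MP \in M.
      apply/varidealP => l; rewrite mcoeff_msupp mcoeffB mcoeffC.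
      case: (eqVneq l 0%MM) => [->|l_nz _]; first by rewrite mulr1 subrr eqxx.
      apply/meetsP; have [i li|l0] := pickP (fun i => 0 < l i)%N; first by exists i.
      case/eqP: l_nz; apply/mnmP => i; rewrite mnm0E; apply/eqP.
      by rewrite -leqn0 leqNgt l0.
    move/varidealP/comp_kill_eq0; rewrite rmorphB /= comp_mpolyC => /eqP.
    by rewrite subr_eq0 => /eqP.
  by rewrite rmorphB rmorphM rmorph1 /= cE comp_mpolyC -mpolyCM mulfV // subrr.
have [h [[_ maxh] [[s [sreg sM sh]] _]]] := CM _ maxM.
(* Height: the chain from [varideal K B] up to the origin consists of primes above the edge ideal,
   so it passes to the quotient. *)
have [C [C0 CT Cp Cs]] := varideal_chain K (subsetT B).
have TC i x : (i <= #|setT :\: B|)%N -> monideal T x -> x \in C i.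
  elim: i => [_ Tx|i IHi lti Tx]; first by rewrite C0; apply: TB.
  by apply: (Cs i lti).1; apply: IHi => //; apply: ltnW.
have leh : (#|setT :\: B| <= h)%N.
  apply: maxh; apply: (prime_chain_ext (P := image_ideal edge_pi (C #|setT :\: B|))).
    move=> a; have [x <-] := edge_pi_surj a.
    rewrite !(image_idealE edge_pi_ker) //; last by move=> y; apply: TC.
    exact: ideal_prime_pred.
  exists (fun i => image_ideal edge_pi (C i)); split=> // i lei.
    by apply: (prime_image edge_pi_surj edge_pi_ker) => // x; apply: TC.
  have Ci j := ideal_prime_pred (Cp j).
  have Ii x : monideal T x -> x \in C i by apply: TC; apply: ltnW.
  have Ii' x : monideal T x -> x \in C i.+1 by apply: TC.
  have [sC nC] := Cs i lei; split=> [a|nsub].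
    by have [x <-] := edge_pi_surj a; rewrite !(image_idealE edge_pi_ker) //; apply: sC.
  apply: nC => x; have := nsub (edge_pi x).
  by rewrite !(image_idealE edge_pi_ker).
(* Depth: lift the regular sequence and bound its length through the socle monomial killed by the
   variables in [S]. *)
have [s0 s0E] : exists s0, s = map edge_pi s0.
  elim: s {sreg sM sh} => [|a s [s0 ->]]; first by exists [::].
  by have [x <-] := edge_pi_surj a; exists (x :: s0).
rewrite {}s0E size_map in sreg sM sh.
have [wreg _] := (regular_seq_pi edge_pi_surj edge_pi_ker s0).1 sreg.
have [Tm TS stab] := Sm.
have := @depth_le_varideal K n T S 'X_[m] s0 upT.
rewrite sh => /(_ _ _ wreg _)/(leq_trans leh) le.
have {le} : (#|setT :\: B| <= #|~: S|)%N.
  apply: le => [/monidealX|i iS|y ys]; first exact/negP.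
    by rewrite -mpolyXD addmC; apply/monidealX/TS.
  by rewrite -(image_idealE edge_pi_ker) //; apply: sM; apply: map_f.
rewrite setTD -(leq_add2l #|B|) cardsC -(cardsC S) leq_add2r leqNgt.
by rewrite ltBS.
Qed.

Lemma unmixed_edge_ideal L r : prime_filtration L T -> (forall S, L S -> #|S| = r) ->
  unmixed (edge_ideal K D).
Proof.
move=> LT Lr; exists r => P [Pp [f Pf]].
have [|S LS PS] := prime_filtration_associated (f := f) LT Pp.
  by move=> g; rewrite Pf; apply: edge_idealE.
have [c1 max1] := varideal_height K S; rewrite -(Lr S LS); split.
  by apply: prime_chain_ext c1 => x; rewrite PS.
by move=> l Pl; apply: max1; apply: prime_chain_ext Pl.
Qed.

(** A regular sequence of length [r] yields a prime chain of length [r], while any prime chain lies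
    above a prime from [L] and has length at most [r]. One sequence must be regular modulo all
    primes from [L] at once. *)
Lemma cohen_macaulay_edge_ring L r : prime_filtration L T ->
    (forall S, L S -> #|~: S| = r) ->
    (forall (M : R -> Prop) S, is_ideal M -> ~ M 1 ->
       (forall x, ~ M x -> exists y, M (1 - x * y)) -> L S ->
       (forall i, i \in S -> M 'X_i) ->
     exists s, [/\ size s = r, forall x, x \in s -> M x
       & forall S', L S' -> weakly_regular (monideal (meets S')) s]) ->
  cohen_macaulay (edge_ring K D).
Proof.
move=> LT Lr Lreg m mm; pose M := preim_ideal edge_pi m.
have mp := maximal_prime mm; have Mp : prime_ideal M := prime_preim edge_pi mp.
have Mi := ideal_prime_pred Mp.
have TM x : monideal T x -> x \in M.
  by move/edge_pi_ker => x0; rewrite preim_idealE x0; case: mp => -[].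
have [S LS SM] := prime_filtration_sub LT Mp TM.
have Minv x : ~ x \in M -> exists y, 1 - x * y \in M.
  move/negP/(maximal_inverse mm) => [a]; have [y <-] := edge_pi_surj a => xy.
  by exists y; rewrite preim_idealE rmorphB rmorphM rmorph1.
have M1 : ~ 1 \in M by apply/negP; case: Mp => -[].
have [s [sr sM sreg]] := Lreg (fun x => x \in M) S Mi M1 Minv LS SM.
have dim l (P : {pred edge_ring K D}) : prime_chain P l -> (l <= r)%N.
  move=> Pl; have [Q [Qp Qs TQ]] := prime_chain_preim edge_pi_surj edge_pi_ker Pl.
  have [S' LS' SQ'] := prime_filtration_sub LT (Qp 0%N (leq0n _)) TQ.
  rewrite -(Lr S' LS'); apply: (@dim_varideal K n S' Q) => // x.
  apply: (@varideal_min _ _ _ (fun x => x \in Q 0%N)) => //.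
  exact/ideal_prime_pred/Qp.
have sm : {subset map edge_pi s <= m} by move=> _ /mapP[x /sM xM ->].
have reg : regular_seq (map edge_pi s).
  apply/(regular_seq_pi edge_pi_surj edge_pi_ker); split.
    exact: prime_filtration_regular LT sreg.
  by move/(adjoin_seq_min Mi TM sM).
have chain s' : regular_seq s' -> {subset s' <= m} -> prime_chain m (size s').
  exact: regular_seq_prime_chain.
exists r; split; split.
- by rewrite -sr -(size_map edge_pi); apply: chain.
- by move=> l; apply: dim.
- by exists (map edge_pi s); rewrite size_map.
- by move=> s' reg' sm'; apply: (dim _ m); apply: chain.
Qed.

End Criteria.

(** * Paths *)

Section Filtrations.
Variables (n : nat) (L : {set 'I_n} -> Prop).
Implicit Types (T : 'X_{1..n} -> bool) (S : {set 'I_n}) (m : 'X_{1..n}).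

Lemma prime_filtration_eq T T' : T =1 T' -> prime_filtration L T -> prime_filtration L T'.
Proof. by move=> /boolp.funext->. Qed.

Lemma meetsU1 i S m : meets (i |: S) m = (0 < m i)%N || meets S m.
Proof.
apply/meetsP/orP => [[j /setU1P[->|jS] mj]|[mi|/meetsP[j jS mj]]].
- by left.
- by right; apply/meetsP; exists j.
- by exists i; rewrite ?setU11.
- by exists j; rewrite // !inE jS orbT.
Qed.

Lemma meets_set0 m : meets set0 m = false.
Proof. by apply/meetsP => -[i]; rewrite inE. Qed.

Lemma meetsD1 i S m : i \notin S -> meets S (m + U_(i))%MM = meets S m.
Proof.
move=> iS; apply/meetsP/meetsP => -[j jS mj]; exists j => //; move: mj.
  by rewrite mnmDE mnm1E; case: eqP => [ij|]; [rewrite ij jS in iS|rewrite addn0].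
by rewrite mnmDE addn_gt0 => ->.
Qed.

Lemma upclosed_ge i a : upclosed (fun m : 'X_{1..n} => (a <= m i)%N).
Proof. by move=> m m' am; rewrite mnmDE (leq_trans am) ?leq_addr. Qed.

Lemma upclosed_and T T' : upclosed T -> upclosed T' -> upclosed (fun m => T m && T' m).
Proof. by move=> uT uT' m m' /andP[/uT-> /uT'->]. Qed.

Lemma upclosed_or T T' : upclosed T -> upclosed T' -> upclosed (fun m => T m || T' m).
Proof. by move=> uT uT' m m' /orP[/uT->//|/uT'->]; rewrite orbT. Qed.

Lemma mnmD1_leq (i j : 'I_n) a m : (a <= (m + U_(i))%MM j)%N =
  (if i == j then a <= (m j).+1 else a <= m j)%N.
Proof. by rewrite mnmDE mnm1E; case: eqP; rewrite ?addn1 ?addn0. Qed.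

Lemma prime_filtration_power S j b : j \notin S -> L (j |: S) ->
  prime_filtration L (fun m => (b <= m j)%N || meets S m).
Proof.
move=> jS Lj; elim: b => [|b IHb]; first exact: filtration_total.
apply: (@filtration_step _ _ _ j).
- exact/upclosed_or/meets_upclosed/upclosed_ge.
- apply: prime_filtration_eq (filtration_prime Lj) => m; rewrite meetsU1.
  by rewrite orbAC; congr (_ || _); apply/idP/orP => [->|[/(leq_ltn_trans _)->//|]]; auto.
- apply: prime_filtration_eq IHb => m.
  by rewrite mnmD1_leq eqxx ltnS meetsD1.
Qed.

(** Each of the [a] colons by ['X_i] splits off a factor with prime [i |: S]; what remains is a
    power of ['X_j]. *)
Lemma prime_filtration_product S i j a b : i != j -> i \notin S -> j \notin S ->
    L (i |: S) -> L (j |: S) ->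
  prime_filtration L (fun m => (a <= m i)%N && (b <= m j)%N || meets S m).
Proof.
move=> ij iS jS Li Lj; elim: a => [|a IHa]; first exact: prime_filtration_power.
apply: (@filtration_step _ _ _ i).
- by apply: upclosed_or (@meets_upclosed _ _); apply: upclosed_and; apply: upclosed_ge.
- apply: prime_filtration_eq (filtration_prime Li) => m; rewrite meetsU1.
  rewrite orbAC; congr (_ || _).
  by case: (ltnP a (m i)) => [/(leq_ltn_trans (leq0n _))->|_] /=; rewrite ?orbT.
- apply: prime_filtration_eq IHa => m.
  by rewrite !mnmD1_leq eqxx ltnS (negPf ij) meetsD1.
Qed.

(* The ideal (x1^a x2^b, x2 x3^c, x3^c x4^d): adding [x3] gives
   (x1^a x2^b, x3), and [c] colons by [x3] lead to (x2, x4^d). *)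
Lemma prime_filtration_path4 p1 p2 p3 p4 a b c d : uniq [:: p1; p2; p3; p4] ->
    (0 < b)%N -> L [set p1; p3] -> L [set p2; p3] -> L [set p4; p2] ->
  prime_filtration L (fun m => [|| (a <= m p1)%N && (b <= m p2)%N,
    (0 < m p2)%N && (c <= m p3)%N | (c <= m p3)%N && (d <= m p4)%N]).
Proof.
rewrite /= !inE !negb_or => /and4P[/and3P[n12 n13 n14] /andP[n23 n24] n34 _].
move=> b_gt0 L13 L23 L42; elim: c => [|c IHc].
  (* For [c = 0] the generator [x2] absorbs [x1^a x2^b], since [b] is positive. *)
  apply: prime_filtration_eq (@prime_filtration_power [set p2] p4 d _ L42) => [m|]; last first.
    by rewrite inE eq_sym.
  rewrite -[[set p2]]setU0 meetsU1 meets_set0 orbF /= andbT orbC.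
  have [m2|m2] := leqP b (m p2); last by rewrite andbF.
  by rewrite (leq_trans b_gt0 m2) orbT.
apply: (@filtration_step _ _ _ p3).
- by do !apply: upclosed_or; apply: upclosed_and; apply: upclosed_ge.
- have LE := @prime_filtration_product [set p3] p1 p2 a b n12 _ _ L13 L23.
  apply: prime_filtration_eq (LE _ _) => [m||]; rewrite ?inE //.
  rewrite -[[set p3]]setU0 meetsU1 meets_set0 orbF.
  by case: (ltnP c (m p3)) => [/(leq_ltn_trans (leq0n _))->|_]; rewrite ?andbF /= ?orbT ?orbF.
- apply: prime_filtration_eq IHc => m.
  by rewrite !mnmD1_leq eqxx !ltnS [p3 == p1]eq_sym [p3 == p2]eq_sym
    (negPf n13) (negPf n23) (negPf n34).
Qed.

End Filtrations.

(** * Paths on two and four vertices *)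

Section Paths.
Variables (K : fieldType) (n : nat) (D : weighted_oriented_graph 'I_n).
Implicit Types (i j p : 'I_n) (m : 'X_{1..n}).

Definition edge_term i j m :=
  [&& edge D i j, (0 < m i)%N & (weight D j <= m j)%N]
  || [&& edge D j i, (0 < m j)%N & (weight D i <= m i)%N].

Lemma edge_termC i j m : edge_term i j m = edge_term j i m.
Proof. exact: orbC. Qed.

Lemma edge_termE i j m : edge D i j ->
  edge_term i j m = (0 < m i)%N && (weight D j <= m j)%N.
Proof.
by move=> ij; rewrite /edge_term ij (negPf (edge_asymmetric ij)) orbF.
Qed.

Lemma edge_term_exists i j : edge D i j || edge D j i -> exists a b,
  [/\ (0 < a)%N, (0 < b)%N & forall m, edge_term i j m = (a <= m i)%N && (b <= m j)%N].
Proof.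
case/orP=> ij; [exists 1%N, (weight D j)|exists (weight D i), 1%N]; split;
  rewrite ?weight_gt0 // => m; last rewrite edge_termC andbC; exact: edge_termE.
Qed.

Definition path2 p1 p2 := [/\ uniq [:: p1; p2], forall i, i \in [:: p1; p2]
  & forall i j, edge D i j || edge D j i = ((i, j) \in [:: (p1, p2); (p2, p1)])].

(** The vertices are parameters, so the reversed path is another instance and symmetric cases share
    one proof. *)
Definition path4 p1 p2 p3 p4 := [/\ uniq [:: p1; p2; p3; p4],
    forall i, i \in [:: p1; p2; p3; p4]
  & forall i j, edge D i j || edge D j i =
     ((i, j) \in [:: (p1, p2); (p2, p1); (p2, p3); (p3, p2); (p3, p4); (p4, p3)])].

Lemma edge_dividesW i j m : edge_term i j m -> edge_divides D m.
Proof.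
by case/orP=> /and3P[ij mi mj]; apply/edge_dividesP; [exists i, j|exists j, i].
Qed.

Lemma edge_divides_path2 p1 p2 m : path2 p1 p2 -> edge_divides D m = edge_term p1 p2 m.
Proof.
case=> _ _ adj; apply/idP/idP => [/edge_dividesP[i [j [ij mi mj]]]|]; last exact: edge_dividesW.
have: (i, j) \in [:: (p1, p2); (p2, p1)] by rewrite -adj ij.
have ijm : edge_term i j m by rewrite /edge_term ij mi mj.
by rewrite !inE => /orP[] /eqP[<- <-] //; rewrite edge_termC.
Qed.

Lemma edge_divides_path4 p1 p2 p3 p4 m : path4 p1 p2 p3 p4 ->
  edge_divides D m = [|| edge_term p1 p2 m, edge_term p2 p3 m | edge_term p3 p4 m].
Proof.
case=> _ _ adj; apply/idP/idP => [/edge_dividesP[i [j [ij mi mj]]]|]; last first.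
  by case/or3P; apply: edge_dividesW.
have: (i, j) \in [:: (p1, p2); (p2, p1); (p2, p3); (p3, p2); (p3, p4); (p4, p3)].
  by rewrite -adj ij.
have ijm : edge_term i j m by rewrite /edge_term ij mi mj.
have jim : edge_term j i m by rewrite edge_termC.
rewrite !inE !xpair_eqE => /or4P[||| /or3P[||]] /andP[/eqP<- /eqP<-];
  by rewrite ?ijm ?jim ?orbT.
Qed.

Lemma kill_sum (S : {set 'I_n}) p p' : p \notin S -> p' \in S ->
  ('X_p + 'X_p' : {mpoly K[n]}) \mPo kill K S = 'X_p.
Proof. by move=> pS p'S; rewrite rmorphD /= !killX p'S (negPf pS) addr0. Qed.

Lemma peval_sum_mem (M : {mpoly K[n]} -> Prop) f p p' : is_ideal M -> M 'X_p' ->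
  M (peval f 'X_p) -> M (peval f ('X_p + 'X_p')).
Proof.
move=> Mi Mp'; apply: pevalB => //.
by have -> : 'X_p - ('X_p + 'X_p') = - 'X_p' :> {mpoly K[n]}; [ring|apply: idealN].
Qed.

(** The ideal is [(x1^a x2^b)], filtered by [(x1)] and [(x2)]; modulo either prime, [x1 + x2]
    becomes the remaining variable. *)
Lemma path2_criteria p1 p2 : path2 p1 p2 ->
  cohen_macaulay (edge_ring K D) /\ unmixed (edge_ideal K D).
Proof.
move=> P; have [/= u12 all12 adj] := P; rewrite inE andbT in u12.
pose L S := exists p p', [/\ S = [set p'], ('X_p + 'X_p' : {mpoly K[n]}) = 'X_p1 + 'X_p2,
  p != p' & forall i, (i == p) || (i == p')].
have LT : prime_filtration L (edge_divides D).
  have [|a [b [_ _ ab]]] := @edge_term_exists p1 p2; first by rewrite adj mem_head.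
  apply: (prime_filtration_eq (T := fun m => (a <= m p1)%N && (b <= m p2)%N || meets set0 m)).
    by move=> m; rewrite meets_set0 orbF (edge_divides_path2 _ P) ab.
  apply: prime_filtration_product; rewrite ?inE ?setU0 //.
    exists p2, p1; split=> //; first by rewrite addrC.
      by rewrite eq_sym.
    by move=> i; have := all12 i; rewrite !inE orbC.
  by exists p1, p2; split=> // i; have := all12 i; rewrite !inE.
have n2 : n = 2%N.
  rewrite -[n]card_ord -cardsT -(_ : [set p1; p2] = setT) ?cards2 ?u12 //.
  by apply/setP => i; have := all12 i; rewrite !inE.
split; last first.
  by apply: (unmixed_edge_ideal (r := 1%N) K LT) => S [p [p' [-> _ _ _]]]; rewrite cards1.
apply: (cohen_macaulay_edge_ring (r := 1%N) LT) => [S [p [p' [-> _ _ _]]]|M S Mi M1 Minv].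
  by apply/eqP; rewrite -(eqn_add2l #|[set p']|) cardsC cards1 card_ord n2.
move=> [p [p' [-> E npp' pp']]] SM.
(* A single variable remains and serves as both [p] and [q]. *)
have [|f f_nz Mf] := maximal_ideal_peval Mi M1 Minv SM (p := p) (q := p).
  by move=> i; rewrite inE orbb orbC.
exists [:: peval f ('X_p1 + 'X_p2)]; split=> // [x|S' [q [q' [-> E' nqq' _]]]].
  by rewrite inE -E => /eqP->; apply: peval_sum_mem => //; apply: SM; rewrite inE.
split=> // x; apply: (@peval_nzd _ _ _ q) => //; first by rewrite inE.
by rewrite -E'; apply: kill_sum; rewrite inE.
Qed.

Lemma path4_criteria p1 p2 p3 p4 : path4 p1 p2 p3 p4 -> edge D p2 p3 ->
    (edge D p3 p4 -> weight D p3 = 1%N) ->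
  cohen_macaulay (edge_ring K D) /\ unmixed (edge_ideal K D).
Proof.
move=> P e23 w3; have [uP allP adj] := P.
(* [S] takes one vertex from each end edge; the equalities of sums make [x1 + x2] and [x3 + x4]
   reduce to ['X_p] and ['X_q] modulo [S]. *)
pose L S := exists p p' q q', [/\ S = [set p'; q'],
  ('X_p + 'X_p' : {mpoly K[n]}) = 'X_p1 + 'X_p2,
  ('X_q + 'X_q' : {mpoly K[n]}) = 'X_p3 + 'X_p4, uniq [:: p; p'; q; q']
  & forall i, i \in [:: p; p'; q; q']].
have L' p p' q q' : ('X_p + 'X_p' : {mpoly K[n]}) = 'X_p1 + 'X_p2 ->
    ('X_q + 'X_q' : {mpoly K[n]}) = 'X_p3 + 'X_p4 ->
    perm_eq [:: p1; p2; p3; p4] [:: p; p'; q; q'] -> L [set p'; q'].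
  move=> E E' peq; exists p, p', q, q'; split=> //; first by rewrite -(perm_uniq peq).
  by move=> i; rewrite -(perm_mem peq).
have LT : prime_filtration L (edge_divides D).
  have [|a [b [_ b_gt0 ab]]] := @edge_term_exists p1 p2; first by rewrite adj mem_head.
  (* Condition 3 enters here: it gives [x3] the same exponent in the last generator as in the middle
     one, for both orientations of the last edge. *)
  have [d dE] : exists d, forall m, edge_term p3 p4 m = (weight D p3 <= m p3)%N && (d <= m p4)%N.
    have: edge D p3 p4 || edge D p4 p3 by rewrite adj !inE eqxx !orbT.
    case/orP=> e34; last by exists 1%N => m; rewrite edge_termC edge_termE // andbC.
    by exists (weight D p4) => m; rewrite edge_termE // w3.
  apply: (prime_filtration_eq (T := fun m => [|| (a <= m p1)%N && (b <= m p2)%N,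
    (0 < m p2)%N && (weight D p3 <= m p3)%N | (weight D p3 <= m p3)%N && (d <= m p4)%N])).
    by move=> m; rewrite (edge_divides_path4 _ P) ab dE edge_termE.
  apply: prime_filtration_path4 => //.
  - by apply: (L' p2 _ p4) => //; rewrite 1?addrC //; apply/permP => z /=; lia.
  - by apply: (L' p1 _ p4) => //; rewrite 1?addrC //; apply/permP => z /=; lia.
  - by rewrite setUC; apply: (L' p1 _ p3).
have n4 : n = 4%N.
  rewrite -[n]card_ord -[4%N]/(size [:: p1; p2; p3; p4]) -(card_uniqP uP).
  by apply: eq_card => i; rewrite allP.
have card2 p p' q q' : uniq [:: p; p'; q; q'] -> #|[set p'; q']| = 2%N.
  by rewrite cards2 /= !inE !negb_or => /and4P[_ /andP[_ ->]].
split; last first.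
  apply: (unmixed_edge_ideal (r := 2%N) K LT) => S [p [p' [q [q' [-> _ _ u _]]]]].
  exact: card2 u.
apply: (cohen_macaulay_edge_ring (r := 2%N) LT) =>
    [S [p [p' [q [q' [-> _ _ u _]]]]]|M S Mi M1 Minv].
  apply/eqP; rewrite -(eqn_add2l #|[set p'; q']|) cardsC (card2 _ _ _ _ u).
  by rewrite card_ord n4.
move=> [p [p' [q [q' [-> E E' u pq]]]]] SM.
have [|f f_nz Mf] := maximal_ideal_peval Mi M1 Minv SM (p := p) (q := q).
  by move=> i; have := pq i; rewrite !inE; do 4!case: eqP.
have [|g g_nz Mg] := maximal_ideal_peval Mi M1 Minv SM (p := q) (q := p).
  by move=> i; have := pq i; rewrite !inE; do 4!case: eqP.
exists [:: peval f ('X_p1 + 'X_p2); peval g ('X_p3 + 'X_p4)]; split=> // [x|S'].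
  rewrite !inE => /orP[]/eqP->; rewrite -?E -?E'; apply: peval_sum_mem => //;
    by apply: SM; rewrite !inE eqxx ?orbT.
move=> [r [r' [t [t' [-> F F' u' _]]]]].
move: u'; rewrite /= !inE !negb_or => /and4P[/and3P[nrr' nrt nrt'] /andP[nr't nr't'] ntt' _].
apply: (@peval_regular _ _ _ r t) => //; rewrite ?inE ?negb_or ?nrr' ?nrt' //.
- by rewrite eq_sym nr't.
- by rewrite -F; apply: kill_sum; rewrite !inE ?eqxx ?negb_or ?nrr'.
- by rewrite -F'; apply: kill_sum; rewrite !inE ?eqxx ?orbT ?negb_or ?ntt' ?andbT 1?eq_sym.
Qed.

(* With [w = weight D p3 > 1], the monomial [x2^N x3^(w-1)] becomes killed by
   [x1], [x3] and [x4] modulo [I(D)] once [x1] and [x4] are raised enough. *)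
Lemma path4_embedded_socle p1 p2 p3 p4 : path4 p1 p2 p3 p4 -> edge D p2 p3 ->
    edge D p3 p4 -> (1 < weight D p3)%N ->
  exists m, socle_monomial (edge_divides D) [set p1; p3; p4] m.
Proof.
move=> P e23 e34 w3; have [/= uP allP adj] := P.
move: uP; rewrite !inE !negb_or => /and4P[/and3P[n12 n13 n14] /andP[n23 n24] n34 _].
pose N := weight_bound D.
have [m0 m0E] : exists m0 : 'X_{1..n}, forall i,
    m0 i = ((p2 == i) * N + (p3 == i) * (weight D p3).-1)%N.
  exists (U_(p2) *+ N + U_(p3) *+ (weight D p3).-1)%MM => i.
  by rewrite mnmDE !mulmnE !mnm1E.
have [a [b [a0 b0 ab]]] : exists a b, [/\ (0 < a)%N, (0 < b)%N &
    forall m, edge_term p1 p2 m = (a <= m p1)%N && (b <= m p2)%N].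
  by apply: edge_term_exists; rewrite adj mem_head.
apply: (@exists_edge_socle _ D _ m0).
- rewrite (edge_divides_path4 _ P) ab !edge_termE // !m0E.
  rewrite !eqxx [p2 == p1]eq_sym [p3 == p1]eq_sym [p3 == p2]eq_sym.
  rewrite (negPf n12) (negPf n13) (negPf n23) (negPf n24) (negPf n34).
  by have := weight_gt0 D p4; move: a0 w3; lia.
- move=> i; rewrite (edge_divides_path4 _ P) !inE -orbA.
  have w12 : edge_term p1 p2 (m0 + U_(p1) *+ N)%MM.
    rewrite /edge_term !mnmDE !mulmnE !mnm1E.
    have: edge D p1 p2 || edge D p2 p1 by rewrite adj mem_head.
    rewrite !m0E !eqxx (negPf n12) [p2 == p1]eq_sym (negPf n12) [p3 == p1]eq_sym (negPf n13).
    have := weight_le_bound D p1; have := weight_le_bound D p2; rewrite -/N => h2 h1.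
    have Np : (0 < N)%N by [].
    by case/orP=> ->; apply/orP; [left|right]; apply/and3P; split=> //; lia.
  case/or3P=> /eqP->; first by rewrite w12.
    apply/or3P/Or32; rewrite edge_termE // !mnmDE !mulmnE !mnm1E !m0E !eqxx.
    have := weight_le_bound D p3; rewrite -/N => h3.
    by have Np : (0 < N)%N by []; lia.
  apply/or3P/Or33; rewrite edge_termE // !mnmDE !mulmnE !mnm1E !m0E !eqxx.
  have := weight_le_bound D p4; rewrite -/N => h4.
  by move: w3; lia.
move=> j; rewrite !inE !negb_or => /andP[/andP[j1 j3] j4].
have := allP j; rewrite !inE (negPf j1) (negPf j3) (negPf j4) /= orbF => /eqP->.
by rewrite m0E eqxx eq_sym (negPf n23) mul1n mul0n addn0.
Qed.

(** The minimal cover [[set p2; p3]] gives an associated prime of height 2, the embedded one has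
    height 3. *)
Lemma path4_not_criteria p1 p2 p3 p4 : path4 p1 p2 p3 p4 -> edge D p2 p3 ->
    edge D p3 p4 -> (1 < weight D p3)%N ->
  ~ cohen_macaulay (edge_ring K D) /\ ~ unmixed (edge_ideal K D).
Proof.
move=> P e23 e34 w3; have [m Sm] := path4_embedded_socle P e23 e34 w3.
have [/= uP allP adj] := P.
move: uP; rewrite !inE !negb_or => /and4P[/and3P[n12 n13 n14] /andP[n23 n24] n34 _].
have [m' Bm] : exists m', socle_monomial (edge_divides D) [set p2; p3] m'.
  apply: minimal_cover_socle => [i j ij|i].
    have: edge D i j || edge D j i by rewrite ij.
    rewrite adj !inE !xpair_eqE => /or4P[||| /or3P[||]] /andP[/eqP-> /eqP->];
      by rewrite !eqxx ?orbT.
  rewrite !inE => /orP[]/eqP->; [exists p1|exists p4].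
  - by rewrite adj !inE eqxx ?orbT.
  - by rewrite !inE negb_or n12 n13.
  - by rewrite adj !inE eqxx ?orbT.
  - by rewrite !inE negb_or eq_sym n24 eq_sym n34.
have lt : (#|[set p2; p3]| < #|[set p1; p3; p4]|)%N.
  rewrite cards2 n23 -setUA cardsU1 cards2 n34.
  by rewrite !inE negb_or n13 n14.
by split; [apply: not_cohen_macaulay_edge_ring Sm Bm lt|apply: not_unmixed_edge_ideal Sm Bm lt].
Qed.

End Paths.

(* The covers {1, 3, 5, ..} and {0, 2} u {3, 5, ..} are both minimal. *)
Lemma long_path_not_criteria (K : fieldType) (k : nat) (D : weighted_oriented_graph 'I_k) :
    underlying_path D -> (2 < k)%N -> k <> 4%N ->
  ~ cohen_macaulay (edge_ring K D) /\ ~ unmixed (edge_ideal K D).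
Proof.
move=> hpath k2 k4.
pose B : {set 'I_k} := [set i : 'I_k | odd i].
pose S : {set 'I_k} := [set i : 'I_k | [|| i == 0%N :> nat, i == 2%N :> nat | odd i && (2 < i)%N]].
have adj (i j : 'I_k) : edge D i j -> i.+1 = j \/ j.+1 = i.
  by move=> ij; have := hpath i j; rewrite ij => /esym/orP[] /eqP; auto.
have nbr (P : pred nat) (i : 'I_k) j (ltj : (j < k)%N) : i.+1 = j \/ j.+1 = i -> ~~ P j ->
    exists2 j' : 'I_k, edge D i j' || edge D j' i & ~~ P j'.
  move=> ij Pj; exists (Ordinal ltj); rewrite // hpath /=.
  by case: ij => ->; rewrite eqxx ?orbT.
have [m Bm] : exists m, socle_monomial (edge_divides D) B m.
  apply: minimal_cover_socle => [i j /adj ij|i]; rewrite !inE.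
    by case: ij => <-; rewrite /= ?orbN // orNb.
  move=> oi; have ltj : (i.-1 < k)%N by apply: leq_ltn_trans (ltn_ord i); apply: leq_pred.
  have [|//|j ij oj] := nbr odd i _ ltj; [by lia|by lia|].
  by exists j; rewrite ?inE.
have [m' Sm] : exists m, socle_monomial (edge_divides D) S m.
  apply: minimal_cover_socle => [i j /adj ij|i]; rewrite !inE; first by lia.
  pose P (i : nat) := [|| i == 0%N :> nat, i == 2%N :> nat | odd i && (2 < i)%N].
  move=> Pi; have ltik := ltn_ord i.
  have [j [ltj ij Pj]] : exists j, [/\ (j < k)%N, i.+1 = j \/ j.+1 = i & ~~ P j].
    (* Vertices 0 and 2 have neighbour 1. An odd [i > 2] uses [i.+1], or [i.-1] if it is the last
       vertex; then [i = 3] is excluded by [k <> 4]. *)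
    have [i1|i1] := leqP i 2.
      by exists 1%N; split=> //; move: Pi; lia.
    have [ik|ik] := leqP k i.+1; last by exists i.+1; split; [|left|rewrite /P; lia].
    by exists i.-1; rewrite /P; split; [lia|right; lia|lia].
  have [j' ij' Pj'] := nbr P i j ltj ij Pj.
  by exists j'; rewrite ?inE.
have lt : (#|B| < #|S|)%N.
  have lt0 : (0 < k)%N by lia.
  have lt1 : (1 < k)%N by lia.
  pose o0 := Ordinal lt0; pose o1 := Ordinal lt1; pose o2 := Ordinal k2.
  (* [S] replaces vertex 1 of [B] by 0 and 2, so it has one more element. *)
  have -> : S = o0 |: (o2 |: (B :\ o1)).
    by apply/setP => i; rewrite !inE -!val_eqE /=; lia.
  by rewrite !cardsU1 (cardsD1 o1 B) !inE -!val_eqE.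
by split; [apply: not_cohen_macaulay_edge_ring Sm Bm lt|apply: not_unmixed_edge_ideal Sm Bm lt].
Qed.

Lemma underlying_path2 (D : weighted_oriented_graph 'I_2) :
  underlying_path D -> exists p1 p2, path2 D p1 p2.
Proof.
move=> hpath; exists ord0, ord_max; split=> // [i|i j].
  by rewrite !inE -!val_eqE /=; case: i => -[|[|]].
rewrite hpath !inE !xpair_eqE -!val_eqE /=.
by case: i j => -[|[|i]] ? [[|[|j]] ?].
Qed.

Lemma underlying_path4 (D : weighted_oriented_graph 'I_4) :
    underlying_path D -> forall p1 p2 p3 p4 : 'I_4,
  p1 = 0%N :> nat -> p2 = 1%N :> nat -> p3 = 2%N :> nat -> p4 = 3%N :> nat ->
  path4 D p1 p2 p3 p4 /\ path4 D p4 p3 p2 p1.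
Proof.
move=> hpath p1 p2 p3 p4 v1 v2 v3 v4; split; split.
- by rewrite /= !inE -!val_eqE /= v1 v2 v3 v4.
- by move=> i; rewrite !inE -!val_eqE /= v1 v2 v3 v4; case: i => -[|[|[|[|]]]].
- move=> i j; rewrite hpath !inE !xpair_eqE -!val_eqE /= v1 v2 v3 v4.
  by case: i j => -[|[|[|[|i]]]] ? [[|[|[|[|j]]]] ?].
- by rewrite /= !inE -!val_eqE /= v1 v2 v3 v4.
- by move=> i; rewrite !inE -!val_eqE /= v1 v2 v3 v4; case: i => -[|[|[|[|]]]].
- move=> i j; rewrite hpath !inE !xpair_eqE -!val_eqE /= v1 v2 v3 v4.
  by case: i j => -[|[|[|[|i]]]] ? [[|[|[|[|j]]]] ?].
Qed.

(* A vertex of weight at least 2 is not a source, so if its edge to one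
   neighbour points outwards, the edge to the other neighbour points inwards. *)
Lemma heavy_vertex_edge n (D : weighted_oriented_graph 'I_n) p1 p2 p3 p4 :
    (forall x, source D x -> weight D x = 1%N) -> path4 D p1 p2 p3 p4 ->
    edge D p3 p4 -> weight D p3 <> 1%N ->
  edge D p2 p3 /\ (1 < weight D p3)%N.
Proof.
move=> hsource [/= u _ adj] e34 w3; split; last by have := weight_gt0 D p3; lia.
have /forallPn[y /negPn yp3] : ~~ source D p3 by apply/negP => /hsource.
have: edge D y p3 || edge D p3 y by rewrite yp3.
move: u; rewrite !inE !negb_or => /and4P[/and3P[n12 n13 n14] /andP[n23 n24] n34 _].
rewrite adj !inE !xpair_eqE eqxx [p3 == p1]eq_sym [p3 == p2]eq_sym.
rewrite (negPf n13) (negPf n23) (negPf n34) !andbF !andbT /=.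
case/orP=> /eqP E; first by rewrite -E.
by have := edge_asymmetric e34; rewrite -E yp3.
Qed.

Theorem proposition5p6 (K : fieldType) (k : nat) (hk : (1 < k)%N)
    (D : weighted_oriented_graph 'I_k)
    (hpath : underlying_path D)
    (hsource : forall x : 'I_k, source D x -> weight D x = 1%N) :
  (cohen_macaulay (edge_ring K D) <-> unmixed (edge_ideal K D)) /\
  (unmixed (edge_ideal K D) <->
     (k = 2%N \/
      (k = 4%N /\
       (forall x1 x2 : 'I_k, x1 = 0%N :> nat -> x2 = 1%N :> nat ->
          edge D x2 x1 -> weight D x2 = 1%N) /\
       (forall x3 x4 : 'I_k, x3 = 2%N :> nat -> x4 = 3%N :> nat ->
          edge D x3 x4 -> weight D x3 = 1%N)))).
Proof.
set C := (_ \/ _).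
suff [good bad] : (C -> cohen_macaulay (edge_ring K D) /\ unmixed (edge_ideal K D)) /\
    (~ C -> ~ cohen_macaulay (edge_ring K D) /\ ~ unmixed (edge_ideal K D)).
  have [/[dup] c /good[cm un]|/[dup] c /bad[ncm nun]] := boolp.pselect C.
    by split; split.
  by split; split.
have [k2|k2] := eqVneq k 2%N.
  split=> [_|]; last by case; left.
  by subst k; have [p1 [p2 /path2_criteria]] := underlying_path2 hpath; apply.
have [k4|/eqP k4] := eqVneq k 4%N; last first.
  split=> [[/eqP|[]//]|_]; first by rewrite (negPf k2).
  by apply: long_path_not_criteria => //; rewrite ltn_neqAle eq_sym k2.
subst k; pose p (i : nat) : 'I_4 := inord i.
have pE i : (i < 4)%N -> p i = i :> nat by move=> lti; rewrite /p inordK.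
have [P P'] := underlying_path4 hpath (pE 0%N isT) (pE 1%N isT) (pE 2%N isT) (pE 3%N isT).
have p_uniq i (lti : (i < 4)%N) (x : 'I_4) : x = i :> nat -> x = p i.
  by move=> xi; apply: val_inj; rewrite /= pE.
split=> [[//|[_ [h1 h3]]]|nC].
  have [_ _ adj] := P; have: edge D (p 1%N) (p 2%N) || edge D (p 2%N) (p 1%N).
    by rewrite adj !inE eqxx !orbT.
  (* The orientation of the middle edge decides the direction in which the path is read. *)
  case/orP=> e12; [apply: (path4_criteria K P)|apply: (path4_criteria K P')] => //.
    by apply: h3; apply: pE.
  by apply: h1; apply: pE.
(* If condition 3 fails, an inner vertex of weight at least 2 has its end edge pointing outwards;
   the middle edge then points into it. *)
have [/andP[e10 /eqP w1]|n1] := boolP (edge D (p 1%N) (p 0%N) && (weight D (p 1%N) != 1%N)).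
  have [e21 w1'] := heavy_vertex_edge hsource P' e10 w1.
  exact: path4_not_criteria P' e21 e10 w1'.
have [/andP[e23 /eqP w2]|n2] := boolP (edge D (p 2%N) (p 3%N) && (weight D (p 2%N) != 1%N)).
  have [e12 w2'] := heavy_vertex_edge hsource P e23 w2.
  exact: path4_not_criteria P e12 e23 w2'.
case: nC; right; split=> //; split=> x y /p_uniq-> // /p_uniq-> // e.
  by apply/eqP/negPn/negP => w; case/negP: n1; rewrite e.
by apply/eqP/negPn/negP => w; case/negP: n2; rewrite e.
Qed.
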